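(* There exist universal constants $c_1, C, C'>0$ such that the following holds. Let $\bm{M}^\star=\lambda^\star\bm{u}^\star\bm{u}^{\star\top}\in\mathbb{R}^{n\times n}$ be a rank-1 symmetric matrix ($\lambda^\star\neq 0$, $\|\bm{u}^\star\|_2=1$) with incoherence parameter $\mu$, and let $\bm{M}=\bm{M}^\star+\bm{H}$, where the random noise matrix $\bm{H}$ satisfies the noise assumption with parameters $\sigma,B$ (see context). Suppose $$\max\{\sigma\sqrt{n\log n},\,B\log n\}\le c_1|\lambda^\star|.$$ Let $\lambda$ and $\bm{u}$ be the leading eigenvalue and leading eigenvector of $\bm{M}$. Then for any fixed vector $\bm{a}\in\mathbb{R}^n$ with $\|\bm{a}\|_2=1$, with probability at least $1-C'n^{-10}$, $$\left|\bm{a}^\top\left(\bm{u}-\frac{\bm{u}^{\star\top}\bm{u}}{\lambda/\lambda^\star}\,\bm{u}^\star\right)\right|\le C\,\frac{\max\{\sigma\sqrt{n\log n},\,B\log n\}}{|\lambda^\star|}\sqrt{\frac{\mu}{n}}.$$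
   Context: Noise assumption with parameters $\sigma=\sigma_n\ge 0$, $B=B_n>0$ on a random matrix $\bm{H}=[H_{ij}]\in\mathbb{R}^{n\times n}$: (1) the entries $H_{ij}$, $1\le i,j\le n$, are independent (no symmetry is imposed, and they need not be identically distributed); (2) $\mathbb{E}[H_{ij}]=0$; (3) $\mathrm{Var}(H_{ij})\le\sigma^2$; (4) each $H_{ij}$ satisfies either (a) $|H_{ij}|\le B$, or (b) $H_{ij}$ has a symmetric distribution with $\mathbb{P}\{|H_{ij}|>B\}\le c_{\mathrm b}n^{-12}$, where $c_{\mathrm b}>0$ is a fixed universal constant. Incoherence parameter of $\bm{M}^\star=\lambda^\star\bm{u}^\star\bm{u}^{\star\top}$: the smallest $\mu$ with $\|\bm{u}^\star\|_\infty\le\sqrt{\mu/n}$. The leading eigenvalue $\lambda$ of the (generally asymmetric) matrix $\bm{M}$ is its eigenvalue of largest modulus; the leading eigenvector $\bm{u}$ is an associated (right) eigenvector with $\|\bm{u}\|_2=1$, taken real whenever $\lambda$ is real. *)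

(* Defs.v *)
From HB Require Import structures.
From mathcomp Require Import all_boot all_order all_algebra.
From mathcomp Require Import all_classical all_reals all_analysis.
From mathcomp Require Import complex.

Set Implicit Arguments.
Unset Strict Implicit.
Unset Printing Implicit Defensive.

Import Order.TTheory GRing.Theory Num.Theory.
Import numFieldNormedType.Exports.

Local Open Scope classical_set_scope.
Local Open Scope ring_scope.

Definition l2norm (R : realType) (n : nat) (v : 'cV[R]_n) : R :=
  Num.sqrt (\sum_(i < n) v i 0 ^+ 2).

Definition l2normC (R : realType) (n : nat) (v : 'cV[R[i]]_n) : R :=
  Num.sqrt (\sum_(i < n) Normc.normc (v i 0) ^+ 2).

Definition complexify (R : realType) (m n : nat) (A : 'M[R]_(m, n)) :
    'M[R[i]]_(m, n) :=
  map_mx (real_complex R) A.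

Definition leading_eigenvalue (R : realType) (n : nat) (A : 'M[R]_n)
    (l : R[i]) : Prop :=
  eigenvalue (complexify A) l /\
  forall l' : R[i], eigenvalue (complexify A) l' ->
    Normc.normc l' <= Normc.normc l.

Definition leading_eigenpair (R : realType) (n : nat) (A : 'M[R]_n)
    (l : R[i]) (u : 'cV[R[i]]_n) : Prop :=
  [/\ leading_eigenvalue A l,
      complexify A *m u = l *: u,
      l2normC u = 1 &
      complex.Im l = 0 -> forall i : 'I_n, complex.Im (u i 0) = 0].

(* On column vectors the norm `|u| of the library is the sup norm. *)
Definition incoherence_bound (R : realType) (n : nat) (u : 'cV[R]_n)
    (mu : R) : Prop :=
  0 <= mu /\ `|u| <= Num.sqrt (mu / n%:R).

Definition incoherence_parameter (R : realType) (n : nat) (u : 'cV[R]_n)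
    (mu : R) : Prop :=
  incoherence_bound u mu /\
  forall mu' : R, incoherence_bound u mu' -> mu <= mu'.

Definition mutually_independent (d : measure_display) (T : measurableType d)
    (R : realType) (P : probability T R) (I : finType)
    (X : I -> {RV P >-> R}) : Prop :=
  forall (J : {set I}) (A : I -> set R), (forall i, measurable (A i)) ->
    P (\bigcap_(i in [set` J]) X i @^-1` A i) =
    (\prod_(i in J) P (X i @^-1` A i))%E.

Definition symmetric_distribution (d : measure_display) (T : measurableType d)
    (R : realType) (P : probability T R) (X : {RV P >-> R}) : Prop :=
  forall A : set R, measurable A ->
    distribution P X A = P ((fun w => - X w) @^-1` A).

(* 'E_P[X] = 0 already entails integrability of X: when the integral of the
   positive or of the negative part is infinite, 'E_P[X] is infinite. *)
Record noise_assumption (d : measure_display) (T : measurableType d)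
    (R : realType) (P : probability T R) (cb : R) (n : nat) (sigma B : R)
    (H : 'I_n -> 'I_n -> {RV P >-> R}) : Prop := {
  noise_independent :
    mutually_independent (fun ij : 'I_n * 'I_n => H ij.1 ij.2);
  noise_centered : forall i j, ('E_P[H i j] = 0)%E;
  noise_variance : forall i j, ('V_P[H i j] <= (sigma ^+ 2)%:E)%E;
  noise_tail : forall i j,
    {ae P, forall w, (`|H i j w| <= B)%R} \/
    (symmetric_distribution (H i j) /\
     (P [set w | (B < `|H i j w|)%R] <= (cb * n%:R ^- 12)%:E)%E) }.

Definition noise_matrix (d : measure_display) (T : measurableType d)
    (R : realType) (P : probability T R) (n : nat)
    (H : 'I_n -> 'I_n -> {RV P >-> R}) (w : T) : 'M[R]_n :=
  \matrix_(i, j) H i j w.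

(* Inner probability: the set A itself need not be measurable. *)
Definition with_probability_at_least (d : measure_display)
    (T : measurableType d) (R : realType) (P : probability T R) (p : R)
    (A : set T) : Prop :=
  exists E : set T, [/\ measurable E, E `<=` A & (p%:E <= P E)%E].

(* Main.v *)
Require Import Defs.
From HB Require Import structures.
From mathcomp Require Import all_boot all_order all_algebra.
From mathcomp Require Import all_classical all_reals all_analysis.
From mathcomp Require Import complex.
From mathcomp Require Import measurable_realfun polyrcf.
From mathcomp Require Import ring lra zify.

(** Write H for the noise and K for the maximum in the hypothesis. Iterating
    [lambda u = lambda* (u*^T u) u* + H u] expands the vector in the theorem as
    a sum of multiples of [H^s u*], [1 <= s < S], plus a remainder in [H^S],
    with S of order log n. So it is enough to have
    [|a^T H^s u*| <= (A K)^s sqrt(mu/n)], [|u*^T H^s u*| <= (A K)^s] and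
    [|(H^s)_ij| <= (A K)^s] for s up to S, each outside an event of probability
    n^-14; the operator norm of H is not needed.

    These bounds come from moments of order q with q s of order log n. Truncate
    H at B. Expanding the power over q-tuples of walks of length s, only tuples
    in which every directed edge occurs twice have a nonzero expectation. If a
    tuple has p distinct edges, it is determined by the p heads of these edges:
    the tail of an edge is the head of the edge preceding one of its
    occurrences, unless all its occurrences are first edges. In that last case
    the tail v has weight at most [a_v^2], and these weights sum to 1. Hence for
    a given pattern of coincidences the total weight is at most n^p. Asymmetry
    enters here: an edge and its reverse carry independent entries, so a
    coincidence of edges identifies heads with heads and tails with tails.

    The lower bound [|lambda| >= |lambda*|/2] is obtained from a real eigenvalue
    of M beyond lambda*/2: by the matrix determinant lemma the characteristic
    polynomial of M has the wrong sign there. *)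

Set Implicit Arguments.
Unset Strict Implicit.
Unset Printing Implicit Defensive.

Import Order.TTheory GRing.Theory Num.Theory.
Import numFieldNormedType.Exports.

Local Open Scope ring_scope.

(** * Counting walks whose edges are all repeated *)

Definition ffun_cons (T : Type) (s : nat) (i : T) (y : {ffun 'I_s -> T}) :
    {ffun 'I_s.+1 -> T} :=
  [ffun t => if unlift ord0 t is Some t' then y t' else i].

Lemma ffun_cons0 (T : Type) (s : nat) (i : T) (y : {ffun 'I_s -> T}) :
  ffun_cons i y ord0 = i.
Proof. by rewrite ffunE unlift_none. Qed.

Lemma ffun_consS (T : Type) (s : nat) (i : T) (y : {ffun 'I_s -> T}) t :
  ffun_cons i y (lift ord0 t) = y t.
Proof. by rewrite ffunE liftK. Qed.

Lemma sum_ffun_cons (V : nmodType) (T : finType) (s : nat)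
    (F : {ffun 'I_s.+1 -> T} -> V) :
  \sum_x F x = \sum_i \sum_(y : {ffun 'I_s -> T}) F (ffun_cons i y).
Proof.
rewrite pair_bigA /=.
rewrite (reindex (fun p : T * {ffun 'I_s -> T} => ffun_cons p.1 p.2)) //=.
exists (fun x : {ffun 'I_s.+1 -> T} => (x ord0, [ffun t => x (lift ord0 t)])).
  move=> [i y] _ /=; rewrite ffun_cons0; congr pair.
  by apply/ffunP => t; rewrite ffunE ffun_consS.
move=> x _ /=; apply/ffunP => t; rewrite ffunE.
by case: unliftP => [t' ->|->]; rewrite ?ffunE.
Qed.

Definition walk_weight (R : comPzRingType) (n s : nat) (A : 'M[R]_n)
    (x : {ffun 'I_s.+1 -> 'I_n}) : R :=
  \prod_(t < s) A (x (widen_ord (leqnSn s) t)) (x (lift ord0 t)).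

(** The left weight [f] is arbitrary so that the induction closes: peeling off the first vertex [i]
    turns it into [f i * A i j] as a function of the next vertex [j]. *)
Lemma expmx_mul_walks (R : comPzRingType) (n s : nat) (A : 'M[R]_n)
    (v : 'cV[R]_n) (f : 'I_n -> R) :
  \sum_i f i * (A ^+ s *m v) i 0 =
  \sum_(x : {ffun 'I_s.+1 -> 'I_n})
     f (x ord0) * walk_weight A x * v (x ord_max) 0.
Proof.
rewrite /walk_weight; elim: s f => [|s IH] f.
  rewrite sum_ffun_cons; apply: eq_bigr => i _.
  rewrite expr0 mul1mx.
  rewrite (bigD1 [ffun=> i]) //= [X in _ + X]big1 ?addr0; last first.
    by move=> y /negP[]; apply/eqP/ffunP; case.
  rewrite big_ord0 mulr1 (_ : ord_max = ord0); last exact: val_inj.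
  by rewrite ffun_cons0.
rewrite sum_ffun_cons; apply: eq_bigr => i _.
rewrite exprS -mulmxA mxE big_distrr /=.
under eq_bigr do rewrite mulrA.
rewrite (IH (fun j => f i * A i j)); apply: eq_bigr => y _.
rewrite big_ord_recl ffun_cons0 !ffun_consS.
have -> : widen_ord (leqnSn s.+1) ord0 = ord0 by apply: val_inj.
rewrite ffun_cons0 (_ : ord_max = lift ord0 ord_max); last exact: val_inj.
rewrite ffun_consS !mulrA; congr (_ * _ * _).
apply: eq_bigr => t _.
have -> : widen_ord (leqnSn s.+1) (lift ord0 t) =
          lift ord0 (widen_ord (leqnSn s) t) by apply: val_inj.
by rewrite !ffun_consS.
Qed.

Lemma bilinear_walks (R : comPzRingType) (n s : nat) (A : 'M[R]_n)
    (a v : 'cV[R]_n) :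
  (a^T *m (A ^+ s *m v)) 0 0 =
  \sum_(x : {ffun 'I_s.+1 -> 'I_n})
     a (x ord0) 0 * walk_weight A x * v (x ord_max) 0.
Proof.
rewrite mxE -(expmx_mul_walks s A v (fun i => a i 0)).
by apply: eq_bigr => i _; rewrite mxE.
Qed.

Definition walk_family (n q s : nat) : finType :=
  {ffun 'I_q -> {ffun 'I_s.+1 -> 'I_n}}.

Definition edge (n q s : nat) (X : walk_family n q s) (j : 'I_q * 'I_s) :
    'I_n * 'I_n :=
  (X j.1 (widen_ord (leqnSn s) j.2), X j.1 (lift ord0 j.2)).

Lemma bilinear_exp_walks (R : comPzRingType) (n q s : nat) (A : 'M[R]_n)
    (a v : 'cV[R]_n) :
  (a^T *m (A ^+ s *m v)) 0 0 ^+ q =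
  \sum_(X : walk_family n q s)
     (\prod_b (a (X b ord0) 0 * v (X b ord_max) 0))
     * \prod_(j : 'I_q * 'I_s) A (edge X j).1 (edge X j).2.
Proof.
rewrite bilinear_walks -[q in LHS]card_ord -prodr_const bigA_distr_bigA.
apply: eq_bigr => X _; rewrite -(pair_bigA _ (fun b t =>
  A (edge X (b, t)).1 (edge X (b, t)).2)) -big_split /=.
by apply: eq_bigr => b _; rewrite /walk_weight /= mulrAC.
Qed.

(** Coincidences beyond those prescribed by [pi] are allowed, so the condition is a mere conjunction
    of equations; it serves only for upper bounds. *)
Definition merges_edges (n q s : nat) (pi : {ffun 'I_q * 'I_s -> 'I_q * 'I_s})
    (X : walk_family n q s) : bool :=
  [forall j, edge X (pi j) == edge X j].

(* [pi] sends every edge position to a representative of its block of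
   coinciding positions, and no block is a singleton. *)
Definition repeated_blocks (J : finType) (pi : {ffun J -> J}) : Prop :=
  (forall j, pi (pi j) = pi j) /\
  (forall j, exists2 j', j' != pi j & pi j' = pi j).

(* The slots of a family of walks that determine it once its edges are merged by
   [pi]: the head of every representative edge, and the tail of a representative
   whose block contains only first edges. The tail of any other edge is the
   head of the edge before some member of its block. *)
Definition free_slot (q s : nat) (pi : {ffun 'I_q * 'I_s.+1 -> 'I_q * 'I_s.+1})
    (p : 'I_q * 'I_s.+2) : bool :=
  if unlift ord0 p.2 is Some t then pi (p.1, t) == (p.1, t)
  else (pi (p.1, ord0) == (p.1, ord0)) &&
       [forall j, (pi j == (p.1, ord0)) ==> (j.2 == ord0)].

(** Slots that are not free receive the default [v0], so that all families land in one function
    space, over which a product weight sums to a product. *)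
Definition free_values (n q s : nat) (v0 : 'I_n)
    (pi : {ffun 'I_q * 'I_s.+1 -> 'I_q * 'I_s.+1})
    (X : walk_family n q s.+1) : {ffun 'I_q * 'I_s.+2 -> 'I_n} :=
  [ffun p => if free_slot pi p then X p.1 p.2 else v0].

(** Heads are recovered first, each being the head of its representative edge. This gives every
    vertex of a walk except the first, which is the tail of a first edge and so of its
    representative [d]. *)
Lemma free_values_inj (n q s : nat) (v0 : 'I_n)
    (pi : {ffun 'I_q * 'I_s.+1 -> 'I_q * 'I_s.+1}) :
  (forall j, pi (pi j) = pi j) ->
  {in merges_edges pi &, injective (@free_values n q s v0 pi)}.
Proof.
move=> idem X Y /forallP mX /forallP mY /ffunP eXY.
have slot b t : free_slot pi (b, t) -> X b t = Y b t.
  by move=> fbt; move: (eXY (b, t)); rewrite !ffunE fbt.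
have heads b t : X b (lift ord0 t) = Y b (lift ord0 t).
  case: (eqP (mX (b, t))) => _ <-; case: (eqP (mY (b, t))) => _ <-.
  by apply: slot; rewrite /free_slot /= liftK -surjective_pairing idem.
apply/ffunP => b; apply/ffunP => t; case: (unliftP ord0 t) => [t' ->|->] //.
pose d := pi (b, ord0).
have w0 : widen_ord (leqnSn s.+1) ord0 = ord0 by apply: val_inj.
suff: (edge X d).1 = (edge Y d).1.
  case: (eqP (mX (b, ord0))) => + _; case: (eqP (mY (b, ord0))) => + _.
  by rewrite /edge /= w0 => -> ->.
(* If the block of [d] has only first edges, the tail of [d] is a free slot. Otherwise some member
   has a predecessor in its walk, whose head is already known. *)
case/boolP: [forall j, (pi j == d) ==> (j.2 == ord0)] => [start|].
  have d2 : d.2 = ord0.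
    by apply/eqP; move/forallP: start => /(_ d); rewrite idem eqxx.
  rewrite /edge /= d2 w0; apply: slot; rewrite /free_slot unlift_none.
  have -> : (d.1, ord0) = d by rewrite -d2 -surjective_pairing.
  by rewrite idem eqxx.
rewrite negb_forall => /existsP[[c t1]]; rewrite negb_imply /= => /andP[/eqP
    ed].
case: (unliftP ord0 t1) => [t2 et|->]; last by rewrite eqxx.
move=> _; change ((edge X d).1 = (edge Y d).1); rewrite -ed (eqP (mX (c, t1)))
    (eqP (mY (c, t1))) et /edge /=.
have -> : widen_ord (leqnSn s.+1) (lift ord0 t2) =
   lift ord0 (widen_ord (leqnSn s) t2) by apply: val_inj.
exact: heads.
Qed.

Lemma big_pairE (R : Type) (idx : R) (op : Monoid.com_law idx) (I J : finType)
    (F : I * J -> R) :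
  \big[op/idx]_p F p = \big[op/idx]_i \big[op/idx]_j F (i, j).
Proof. by rewrite pair_bigA; apply: eq_bigr => -[]. Qed.

Lemma ler_prod_subset (R : numDomainType) (I : finType) (A B : pred I)
    (F : I -> R) :
  (forall i, 0 <= F i <= 1) -> {subset B <= A} ->
  \prod_(i in A) F i <= \prod_(i in B) F i.
Proof.
move=> F01 BA; rewrite (bigID (mem B)) /=.
rewrite (eq_bigl (mem B)) => [|i]; last first.
  by rewrite inE /= andbC; case: (boolP (i \in B)) => // /BA ->.
apply: ler_piMr; first by apply: prodr_ge0 => i _; case/andP: (F01 i).
exact: prodr_ile1.
Qed.

Lemma ler_sum_inj (R : numDomainType) (I J : finType) (A : pred I)
    (h : I -> J) (F : J -> R) :
  {in A &, injective h} -> (forall j, 0 <= F j) ->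
  \sum_(i | A i) F (h i) <= \sum_j F j.
Proof.
move=> injh F0; rewrite -[leLHS](big_imset F injh) /= (bigID (mem (h @: A))
    predT) /=.
by rewrite lerDl; apply: sumr_ge0.
Qed.

(** The block of a free start holds only first edges and at least two of them, so another walk, its
    mate, starts at the same vertex and supplies the second factor of the square. Mates are distinct
    and not free; all remaining factors are at most 1. *)
Lemma prod_starts_le (R : numDomainType) (n q s : nat)
    (pi : {ffun 'I_q * 'I_s.+1 -> 'I_q * 'I_s.+1}) (X : walk_family n q s.+1)
    (alpha : 'I_n -> R) :
  repeated_blocks pi -> merges_edges pi X ->
  (forall i, 0 <= alpha i <= 1) ->
  \prod_b alpha (X b ord0) <=
  \prod_(b | free_slot pi (b, ord0)) alpha (X b ord0) ^+ 2.
Proof.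
move=> [idem twice] /forallP mX alpha01.
pose fb b := free_slot pi (b, ord0 : 'I_s.+2).
have fbE b : fb b = (pi (b, ord0) == (b, ord0)) &&
       [forall j, (pi j == (b, ord0)) ==> (j.2 == ord0)].
  by rewrite /fb /free_slot unlift_none.
pose mate b := odflt b [pick c | (c != b) && (pi (c, ord0) == (b, ord0))].
have mateP b : fb b -> mate b != b /\ pi (mate b, ord0) = (b, ord0).
  rewrite fbE => /andP[/eqP pib /forallP start]; rewrite /mate.
  case: pickP => [c /andP[-> /eqP ->] //|none].
  have [[c t]] := twice (b, ord0); rewrite pib => cb pic.
  have := start (c, t); rewrite pic eqxx /= => /eqP t0.
  rewrite t0 in cb pic; have := none c; rewrite /= pic eqxx andbT =>
      /negbFE/eqP cE.
  by rewrite cE eqxx in cb.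
have mate_inj : {in fb &, injective mate}.
  move=> b b' /mateP[_ eb] /mateP[_ eb'] emate.
  by move: eb; rewrite emate eb' => -[].
have mate_nfb b : fb b -> ~~ fb (mate b).
  move=> /mateP[neq eb]; rewrite fbE eb negb_and; apply/orP; left.
  by apply: contra neq => /eqP[<-].
have mateX b : fb b -> X (mate b) ord0 = X b ord0.
  have w0 : widen_ord (leqnSn s.+1) ord0 = ord0 by apply: val_inj.
  move=> /mateP[_ eb]; have := mX (mate b, ord0).
  by rewrite eb /edge /= w0 => /eqP[->].
rewrite (bigID fb) /= -[X in _ <= X]/(\prod_(b | fb b) alpha (X b ord0) ^+ 2).
under [leRHS]eq_bigr do rewrite expr2; rewrite big_split /=.
apply: ler_wpM2l; first by apply: prodr_ge0 => b _; case/andP: (alpha01 (X b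
    ord0)).
apply: (@le_trans _ _ (\prod_(b in mate @: fb) alpha (X b ord0))).
  apply: (@ler_prod_subset _ _ (fun b => ~~ fb b)) => // b.
  by case/imsetP => c fc ->; apply: mate_nfb.
rewrite big_imset //= (eq_bigr (fun b => alpha (X b ord0))) // => b fb_b.
by rewrite mateX.
Qed.

(** By injectivity the sum is at most one over all assignments of vertices to slots, which factors.
    A free head contributes [n], a free start the sum of the [alpha i ^+ 2], at most 1, and any
    other slot is pinned to the default and contributes 1. *)
Lemma sum_merged_walks (R : numDomainType) (n q s : nat)
    (pi : {ffun 'I_q * 'I_s.+1 -> 'I_q * 'I_s.+1}) (alpha : 'I_n -> R) :
  (0 < n)%N -> repeated_blocks pi ->
  (forall i, 0 <= alpha i <= 1) -> \sum_i alpha i ^+ 2 <= 1 ->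
  \sum_(X : walk_family n q s.+1 | merges_edges pi X) \prod_b alpha (X b ord0)
    <= n%:R ^+ #|[set j | pi j == j]|.
Proof.
case: n alpha => // n alpha _ rpi alpha01 sum1.
pose w (p : 'I_q * 'I_s.+2) (v : 'I_n.+1) : R :=
  if free_slot pi p then (if p.2 == ord0 then alpha v ^+ 2 else 1)
  else (v == ord0)%:R.
have w_ge0 p v : 0 <= w p v.
  rewrite /w; do 2 case: ifP => // _; rewrite ?ler0n //.
  by rewrite exprn_ge0 //; case/andP: (alpha01 v).
pose W (f : {ffun 'I_q * 'I_s.+2 -> 'I_n.+1}) := \prod_p w p (f p).
have le_W X : merges_edges pi X ->
    \prod_b alpha (X b ord0) <= W (free_values ord0 pi X).
  move=> mX; apply: (le_trans (prod_starts_le rpi mX alpha01)).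
  rewrite /W big_pairE.
  rewrite big_mkcond /= le_eqVlt; apply/orP; left; apply/eqP.
  apply: eq_bigr => b _; rewrite big_ord_recl big1 ?mulr1.
    by rewrite /w ffunE /=; case: ifP => //= _; rewrite ?eqxx.
  move=> t _; rewrite /w ffunE /=.
  by case: ifP => // ->; rewrite eqxx.
apply: (@le_trans _ _ (\sum_(X | merges_edges pi X) W (free_values ord0 pi X))).
  exact: ler_sum.
apply: (@le_trans _ _ (\sum_f W f)).
  apply: ler_sum_inj => [|f]; last exact: prodr_ge0.
  by apply: free_values_inj; case: rpi.
rewrite -bigA_distr_bigA /= big_pairE /=.
have -> : (n.+1%:R : R) ^+ #|[set j | pi j == j]| =
    \prod_b \prod_t (if pi (b, t) == (b, t) then n.+1%:R else 1).
  rewrite pair_bigA -big_mkcond /= -prodr_const; apply: eq_bigl => j.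
  by rewrite inE -surjective_pairing.
have sum_delta : \sum_(v : 'I_n.+1) ((v == ord0)%:R : R) = 1.
  by rewrite (bigD1 ord0) //= big1 ?addr0 // => v /negPf ->.
have sumw_ge0 p : 0 <= \sum_v w p v by apply: sumr_ge0.
apply: ler_prod => b _; apply/andP; split; first exact: prodr_ge0.
rewrite big_ord_recl -[leRHS]mul1r; apply: ler_pM => //.
- exact: prodr_ge0.
- by rewrite /w; case: (free_slot _ _) => //=; rewrite sum_delta.
- apply: ler_prod => t _; rewrite sumw_ge0 /= /w /= /free_slot /= liftK.
  by case: (_ == (b, t)); rewrite ?sum_delta // sumr_const card_ord.
Qed.

(** * Coincidence patterns and their number *)

Definition is_repeated_blocks (J : finType) (pi : {ffun J -> J}) : bool :=
  [forall j, pi (pi j) == pi j] &&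
  [forall j, exists j', (j' != pi j) && (pi j' == pi j)].

Lemma is_repeated_blocksP (J : finType) (pi : {ffun J -> J}) :
  reflect (repeated_blocks pi) (is_repeated_blocks pi).
Proof.
apply: (iffP andP) => [[/forallP h1 /forallP h2]|[h1 h2]]; split.
- by move=> j; apply/eqP.
- move=> j; have /existsP[j' /andP[ne /eqP e]] := h2 j; by exists j'.
- by apply/forallP => j; apply/eqP.
- apply/forallP => j; apply/existsP; have [j' ne e] := h2 j.
  by exists j'; rewrite ne e eqxx.
Qed.

(** Each fixed point has a second member in its block, which is not a fixed point; distinct blocks
    give distinct members. *)
Lemma double_repeated_blocks (J : finType) (pi : {ffun J -> J}) :
  repeated_blocks pi -> (2 * #|[set j | pi j == j]| <= #|J|)%N.
Proof.
move=> [idem twice]; set D := [set j | _].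
pose mate d := odflt d [pick c | (c != d) && (pi c == d)].
have mateP d : d \in D -> mate d \notin D /\ pi (mate d) = d.
  rewrite inE => /eqP pid; rewrite /mate; case: pickP => [c /andP[ne /eqP
      e]|none].
    by rewrite inE e eq_sym.
  have [c] := twice d; rewrite pid => ne e.
  by have := none c; rewrite /= ne e eqxx.
have mate_inj : {in D &, injective mate}.
  by move=> d d' /mateP[_ e] /mateP[_ e'] h; rewrite -e h e'.
rewrite mul2n -addnn -(cardsC D) leq_add2l -(card_in_imset mate_inj).
apply: subset_leq_card; apply/fintype.subsetP => c /imsetP[d dD ->].
by rewrite inE; case: (mateP d dD).
Qed.

(** Values on [D] are forced, and each other position has at most [#|J|] choices. *)
Lemma sum_functions_fixing (R : numDomainType) (J : finType) (D : {set J}) :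
  \sum_(pi : {ffun J -> J} | [set j | pi j == j] == D) (1 : R) <=
  #|J|%:R ^+ (#|J| - #|D|).
Proof.
have -> : #|J|%:R ^+ (#|J| - #|D|) =
    \prod_(j : J) \sum_(i | (j \in D) ==> (i == j)) (1 : R).
  have -> : (#|J| - #|D|)%N = #|~: D|
    by rewrite -(cardsC D) addKn.
  rewrite -prodr_const big_mkcond /=; apply: eq_bigr => j _.
  rewrite inE; case: (j \in D) => /=; first by rewrite big_pred1_eq.
  by rewrite sumr_const.
rewrite bigA_distr_big_dep.
rewrite [leRHS](bigID (fun pi : {ffun J -> J} => [set j | pi j == j] == D)) /=.
rewrite -[leLHS]addr0; apply: lerD; last first.
  by apply: sumr_ge0 => f _; apply: prodr_ge0.
rewrite le_eqVlt; apply/orP; left; apply/eqP.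
apply: eq_big => [pi|pi _]; last by rewrite big1.
case: eqP => [eD|]; last by rewrite andbF.
rewrite andbT; apply/esym/familyP => j.
by rewrite unfold_in; apply/implyP; rewrite -eD inE.
Qed.

(** The result of [pick] depends only on the predicate, here on the value [e j], so it is constant
    on blocks. The default is never reached, [j] itself being a candidate. *)
Definition block_rep (J : finType) (E : eqType) (e : J -> E) : {ffun J -> J} :=
  [ffun j => odflt j [pick j' | e j' == e j]].

Lemma block_repE (J : finType) (E : eqType) (e : J -> E) j :
  e (block_rep e j) = e j.
Proof. by rewrite ffunE; case: pickP => [j' /eqP|]. Qed.

Lemma block_rep_eq (J : finType) (E : eqType) (e : J -> E) j j' :
  e j = e j' -> block_rep e j = block_rep e j'.
Proof.
move=> h; rewrite !ffunE h; case: pickP => //= none.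
by have := none j'; rewrite eqxx.
Qed.

Lemma card_block_rep (J E : finType) (e : J -> E) :
  #|[set j | block_rep e j == j]| = #|[set e j | j : J]|.
Proof.
have inj : {in [set j | block_rep e j == j] &, injective e}.
  move=> j j'; rewrite !inE => /eqP {2}<- /eqP {2}<- h.
  exact: block_rep_eq.
rewrite -(card_in_imset inj); apply: eq_card => c.
apply/imsetP/imsetP => -[j _ ->]; first by exists j.
exists (block_rep e j); last by rewrite block_repE.
by rewrite inE; apply/eqP/block_rep_eq; rewrite block_repE.
Qed.

Definition all_repeated (J : finType) (E : eqType) (e : J -> E) : bool :=
  [forall j, exists j', (j' != j) && (e j' == e j)].

Lemma block_rep_repeated (J : finType) (E : eqType) (e : J -> E) :
  all_repeated e -> repeated_blocks (block_rep e).
Proof.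
move=> /forallP rep; split=> j; first by apply/block_rep_eq; rewrite block_repE.
have /existsP[j' /andP[ne /eqP e']] := rep (block_rep e j).
by exists j' => //; apply: block_rep_eq; rewrite e' block_repE.
Qed.

(* With [nu = sigma^2 / B^2], the summand bounds, up to the factor [B^(q s)],
    the
   contribution to the [q]-th moment of the walks with edge pattern [X]. *)
Lemma sum_repeated_walks (R : realFieldType) (n q s : nat) (alpha : 'I_n -> R)
    (nu kappa : R) :
  (0 < n)%N -> (0 < s)%N -> 0 <= nu -> 0 < kappa ->
  (q * s)%:R <= kappa -> n%:R * nu * (q * s)%:R <= kappa ^+ 2 ->
  (forall i, 0 <= alpha i <= 1) -> \sum_i alpha i ^+ 2 <= 1 ->
  \sum_(X : walk_family n q s | all_repeated (edge X))
     nu ^+ #|[set edge X j | j : 'I_q * 'I_s]| * \prod_b alpha (X b ord0)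
  <= (2 * kappa) ^+ (q * s).
Proof.
case: s => // s n0 _ nu0 k0 mk nmk alpha01 sum1.
set J := ('I_q * 'I_s.+1)%type; set m := (q * s.+1)%N.
have cardJ : #|{: J}| = m by rewrite card_prod !card_ord.
pose D (pi : {ffun J -> J}) := [set j | pi j == j].
pose F (X : walk_family n q s.+1) := \prod_b alpha (X b ord0).
have F0 X : 0 <= F X.
  by apply: prodr_ge0 => b _; case/andP: (alpha01 (X b ord0)).
rewrite (partition_big (fun X => block_rep (edge X))
   (fun pi => is_repeated_blocks pi)) /=; last first.
  by move=> X /block_rep_repeated/is_repeated_blocksP.
apply: (@le_trans _ _ (\sum_(pi : {ffun J -> J} | is_repeated_blocks pi)
   (nu * n%:R) ^+ #|D pi|)).
  apply: ler_sum => pi /is_repeated_blocksP rpi.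
  (* The families with pattern exactly [pi] are enlarged to all those merged by [pi], to which the
     count of free slots applies. *)
  apply: (@le_trans _ _ (\sum_(X | merges_edges pi X) nu ^+ #|D pi| * F X)).
    rewrite [leRHS](bigID (fun X => all_repeated (edge X) && (block_rep (edge
        X) == pi))) /=.
    rewrite -[leLHS]addr0 lerD ?sumr_ge0 // => [|X _]; last by rewrite mulr_ge0
        ?exprn_ge0.
    rewrite le_eqVlt; apply/orP; left; apply/eqP; apply: eq_big => [X|X].
      case: eqP => [<-|]; last by rewrite !andbF.
      rewrite !andbT; case: (all_repeated _); rewrite ?andbF // andbT.
      by apply/esym/forallP => j; rewrite block_repE.
    by move=> /andP[_ /eqP <-]; rewrite card_block_rep.
  rewrite -mulr_sumr exprMn ler_wpM2l ?exprn_ge0 //.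
  exact: sum_merged_walks.
(* With [p] blocks and [2 * p <= m], the left side regroups as
   [(nu * n * m) ^+ p * m ^+ (m - 2 * p)], where the first base is at most [kappa ^+ 2] and the
   second at most [kappa]. *)
have term (pi : {ffun J -> J}) : is_repeated_blocks pi ->
    (nu * n%:R) ^+ #|D pi| * m%:R ^+ (m - #|D pi|) <= kappa ^+ m.
  move=> /is_repeated_blocksP/double_repeated_blocks; rewrite cardJ -/(D pi).
  set p := #|_| => p2.
  have -> : (m - p = p + (m - 2 * p))%N by lia.
  rewrite exprD mulrA -exprMn [X in _ <= kappa ^+ X](_ : m = 2 * p + (m - 2 *
      p))%N; last by lia.
  rewrite exprD exprM ler_pM ?exprn_ge0 ?mulr_ge0 //.
    by apply: lerXn2r; rewrite ?nnegrE ?mulr_ge0 // ?exprn_ge0 ?(ltW k0) //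
      [nu * _]mulrC.
  by apply: lerXn2r; rewrite ?nnegrE // ltW.
(* Patterns are grouped by their set of representatives; the [2 ^+ m] subsets of positions account
   for the factor 2 in the bound. *)
rewrite (partition_big D predT) //=.
rewrite exprMn; have -> : (2 : R) ^+ m = \sum_(A : {set J}) 1.
  by rewrite sumr_const -cardsT -powersetT card_powerset cardsT cardJ natrX.
rewrite mulr_suml; apply: ler_sum => A _; rewrite mul1r.
(* A single pattern [pi0] with representatives [A] suffices to apply [term], which depends on the
   pattern only through [#|A|]. If there is none, the sum is empty. *)
case: (pickP (fun pi => is_repeated_blocks pi && (D pi == A))) => [pi0|none].
  move=> /andP[/term + /eqP DA]; rewrite DA; apply: le_trans.
  apply: (@le_trans _ _ ((nu * n%:R) ^+ #|A| *
      \sum_(pi : {ffun J -> J} | D pi == A) 1)).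
    rewrite mulr_sumr [leRHS](bigID (fun pi => is_repeated_blocks pi)) /=.
    rewrite -[leLHS]addr0 lerD ?sumr_ge0 // => [|pi _]; last first.
      by rewrite mulr1 exprn_ge0 // mulr_ge0.
    rewrite le_eqVlt; apply/orP; left; apply/eqP.
    apply: eq_big => [pi|pi /andP[_ /eqP ->]]; last by rewrite mulr1.
    by rewrite andbC.
  rewrite ler_wpM2l ?exprn_ge0 ?mulr_ge0 // -cardJ.
  exact: sum_functions_fixing.
by rewrite big_pred0 // exprn_ge0 // ltW.
Qed.

(** * Eigenvalues and eigenvectors of a perturbed rank-one matrix *)

(** Compare the two block triangular factorisations of the bordered matrix with rows [(1, v^T)] and
    [(u, A)], eliminating through either diagonal block. *)
Lemma det_sub_rank1 (F : fieldType) (n : nat) (A : 'M[F]_n) (u v : 'cV[F]_n) :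
  A \in unitmx ->
  \det (A - u *m v^T) = \det A * (1 - (v^T *m invmx A *m u) 0 0).
Proof.
move=> uA; pose B := block_mx (1%:M : 'M[F]_1) v^T u A.
have e1 : B = block_mx 1%:M 0 u 1%:M *m block_mx 1%:M v^T 0 (A - u *m v^T).
  rewrite mulmx_block !mul1mx !mulmx1 !mul0mx !addr0.
  by rewrite addrC subrK.
have e2 : B = block_mx 1%:M (v^T *m invmx A) 0 1%:M *m
              block_mx (1%:M - v^T *m invmx A *m u) 0 u A.
  by rewrite mulmx_block !mul1mx !mul0mx !add0r subrK mulmxKV.
have : \det B = \det B by [].
rewrite {1}e1 e2 !det_mulmx !det_lblock !det_ublock !det1 !mul1r => ->.
by rewrite mulrC det_mx11 !mxE.
Qed.

Lemma horner_char_poly (F : comNzRingType) (n : nat) (A : 'M[F]_n) (z : F) :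
  (char_poly A).[z] = \det (z%:M - A).
Proof.
rewrite /char_poly -horner_evalE -det_map_mx; congr (\det _).
apply/matrixP => i j; rewrite !mxE /= /horner_eval hornerD hornerN hornerC.
by rewrite hornerMn hornerX.
Qed.

Lemma monic_gt0 (R : rcfType) (p : {poly R}) (z0 : R) :
  p \is monic -> (forall z, z0 <= z -> ~~ root p z) -> 0 < p.[z0].
Proof.
move=> pm nroot; rewrite ltNge; apply/negP => p0.
have lc : 0 < lead_coef p by rewrite (monicP pm).
have [b pb] := poly_pinfty_gt_lc lc.
have m1 : z0 <= Num.max z0 b by rewrite le_max lexx.
have /(poly_ivt m1)[z] : p.[z0] <= 0 <= p.[Num.max z0 b].
  by rewrite p0 /= ltW // (lt_le_trans lc) // pb // le_max lexx orbT.
by move=> /andP[/nroot/negP].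
Qed.

Lemma monic_root_above (R : rcfType) (p : {poly R}) (z0 : R) :
  p \is monic -> p.[z0] <= 0 -> exists2 z, z0 <= z & root p z.
Proof.
move=> pm p0; have lc : 0 < lead_coef p by rewrite (monicP pm).
have [b pb] := poly_pinfty_gt_lc lc.
have m1 : z0 <= Num.max z0 b by rewrite le_max lexx.
have /(poly_ivt m1)[z] : p.[z0] <= 0 <= p.[Num.max z0 b].
  by rewrite p0 /= ltW // (lt_le_trans lc) // pb // le_max lexx orbT.
by move=> /andP[? _] ?; exists z.
Qed.

Lemma mulmx_exp_eigen (F : comPzRingType) (n s : nat) (A : 'M[F]_n)
    (v : 'rV[F]_n) (z : F) :
  v *m A = z *: v -> v *m A ^+ s = z ^+ s *: v.
Proof.
move=> Av; elim: s => [|s IH]; first by rewrite !expr0 mulmx1 scale1r.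
by rewrite exprS -mulmxE mulmxA Av -scalemxAl IH scalerA exprS.
Qed.

(** [eigenvalue] refers to row eigenvectors; the l1 norm [N] of such a row satisfies
    [|z|^S N <= n e N]. *)
Lemma eigenvalue_small_power (R : realFieldType) (n S : nat) (A : 'M[R]_n)
    (e z : R) :
  (forall i j, `|(A ^+ S) i j| <= e) -> n%:R * e < `|z| ^+ S ->
  ~~ eigenvalue A z.
Proof.
move=> Ae zS; apply/negP => /eigenvalueP[v /(mulmx_exp_eigen S) vA v0].
pose N := \sum_j `|v 0 j|.
have N0 : 0 < N.
  rewrite lt_def sumr_ge0 // andbT; apply: contra v0 => /eqP N0.
  apply/eqP/rowP => j; rewrite mxE; apply/eqP; rewrite -normr_le0 -N0.
  by rewrite /N (bigD1 j) //= lerDl sumr_ge0.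
have : `|z| ^+ S * N <= n%:R * e * N.
  rewrite mulr_sumr.
  apply: (@le_trans _ _ (\sum_(j < n) e * N)); last first.
    by rewrite sumr_const card_ord -mulrA mulr_natl.
  apply: ler_sum => j _.
  have -> : `|z| ^+ S * `|v 0 j| = `|(v *m A ^+ S) 0 j|.
    by rewrite vA mxE normrM normrX.
  rewrite mxE mulr_sumr; apply: le_trans (ler_norm_sum _ _ _) _.
  by apply: ler_sum => k _; rewrite normrM mulrC ler_wpM2r.
by rewrite ler_pM2r // leNgt zS.
Qed.

(* Iterating [x = z^-1 (c u + A x)]. *)
Lemma neumann_expansion (F : fieldType) (n S : nat) (A : 'M[F]_n)
    (u x : 'cV[F]_n) (c z : F) :
  z != 0 -> z *: x = c *: u + A *m x ->
  x = \sum_(s < S) (c / z ^+ s.+1) *: (A ^+ s *m u) + (z ^+ S)^-1 *: (A ^+ S *m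
      x).
Proof.
move=> z0 xE; elim: S => [|S IH].
  by rewrite big_ord0 expr0 invr1 scale1r add0r expr0 mul1mx.
rewrite {1}IH big_ord_recr /= -addrA; congr (_ + _).
have {1}-> : x = z^-1 *: (c *: u + A *m x) by rewrite -xE scalerA mulVf
    ?scale1r.
rewrite -scalemxAr mulmxDr -scalemxAr scalerA scalerDr scalerA.
by rewrite -!invfM -!exprSr mulmxA mulmxE -exprSr [_^-1 * c]mulrC.
Qed.

Lemma sum_geometric_le (R : realFieldType) (S : nat) (r : R) :
  0 <= r <= 2^-1 -> \sum_(s < S) r ^+ s.+1 <= 2 * r.
Proof.
(* The subtracted term makes the induction close: the step amounts to [2 * r <= 1]. *)
move=> /andP[r0 r1]; suff : \sum_(s < S) r ^+ s.+1 <= 2 * r - 2 * r ^+ S.+1.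
  by move/le_trans; apply; rewrite gerBl mulr_ge0 // exprn_ge0.
elim: S => [|S IH]; first by rewrite big_ord0 expr1 subrr.
rewrite big_ord_recr /=; have := exprn_ge0 S.+1 r0; rewrite (exprS r S.+1); nra.
Qed.

Lemma norm_mulmx_col_le (R : numDomainType) (n : nat) (B : 'M[R]_n)
    (x : 'cV[R]_n) (e : R) (i : 'I_n) :
  (forall i j, `|B i j| <= e) -> `|(B *m x) i 0| <= e * \sum_j `|x j 0|.
Proof.
move=> Be; rewrite mxE mulr_sumr; apply: le_trans (ler_norm_sum _ _ _) _.
by apply: ler_sum => j _; rewrite normrM ler_wpM2r.
Qed.

Lemma norm_bilinear_le (R : numDomainType) (n : nat) (B : 'M[R]_n)
    (a x : 'cV[R]_n) (e : R) :
  (forall i j, `|B i j| <= e) ->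
  `|(a^T *m (B *m x)) 0 0| <= e * (\sum_i `|a i 0|) * \sum_j `|x j 0|.
Proof.
move=> Be; rewrite mxE [e * _]mulrC -mulrA mulr_suml.
apply: le_trans (ler_norm_sum _ _ _) _.
apply: ler_sum => i _; rewrite normrM mxE ler_wpM2l //.
exact: norm_mulmx_col_le.
Qed.

(** The crude [n], in place of its square root, only costs powers of [n] that the [S]-th power of a
    small ratio absorbs. *)
Lemma sum_norm_unit_le (R : realDomainType) (n : nat) (u : 'cV[R]_n) :
  \sum_i u i 0 ^+ 2 = 1 -> \sum_i `|u i 0| <= n%:R.
Proof.
move=> u1; rewrite -[n in leRHS]card_ord -sumr_const; apply: ler_sum => i _.
rewrite -(@ler_pXn2r _ 2) ?nnegrE // expr1n real_normK ?num_real //.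
by rewrite -u1 (bigD1 i) //= lerDl sumr_ge0 // => j _; rewrite sqr_ge0.
Qed.

(** At [z0 = lam / 2] the characteristic polynomial of [H] is positive, as it is monic with no root
    from [z0] on. The rank-one term multiplies it by [1 - lam * u^T (z0 - H)^-1 u], which is close
    to [1 - lam / z0 = -1], so a root of the perturbed polynomial lies above [z0]. *)
Lemma large_eigenvalue (R : rcfType) (n S : nat) (H : 'M[R]_n) (u : 'cV[R]_n)
    (lam rho : R) :
  (0 < S)%N -> 0 < lam -> 0 <= rho ->
  rho / (lam / 2) <= 50^-1 -> n%:R ^+ 3 * (rho / (lam / 2)) ^+ S <= 32^-1 ->
  \sum_i u i 0 ^+ 2 = 1 ->
  (forall s, (0 < s < S)%N -> `|(u^T *m (H ^+ s *m u)) 0 0| <= rho ^+ s) ->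
  (forall s i j, (0 < s <= S)%N -> `|(H ^+ s) i j| <= rho ^+ s) ->
  exists2 z, lam / 2 <= z & eigenvalue (lam *: (u *m u^T) + H) z.
Proof.
case: S => // S _ lam0 rho0 r50 nr u1 Hu Hij; set z0 := lam / 2 in r50 nr *.
set r := rho / z0 in r50 nr; have z00 : 0 < z0 by rewrite divr_gt0.
have r0 : 0 <= r by rewrite divr_ge0 // ltW.
have rhoE : rho = r * z0 by rewrite divfK ?lt0r_neq0.
have n1 : 1 <= n%:R :> R.
  rewrite ler1n lt0n; apply/negP => /eqP n0.
  move: u1; rewrite big1 => [/esym/eqP|i _]; first by rewrite oner_eq0.
  by have := ltn_ord i; rewrite [X in (_ < X)%N]n0.
have rS0 : 0 <= r ^+ S.+1 by exact: exprn_ge0.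
have nrS : n%:R * r ^+ S.+1 <= 32^-1.
  by apply: le_trans nr; rewrite ler_wpM2r // -[leLHS]expr1 ler_weXn2l.
have noH z : z0 <= z -> ~~ root (char_poly H) z.
  move=> z0z; have zp : 0 < z := lt_le_trans z00 z0z.
  rewrite -eigenvalue_root_char; apply: (@eigenvalue_small_power _ _ S.+1 _
      (rho ^+ S.+1)).
    by move=> i j; apply: Hij; rewrite /= leqnn.
  rewrite gtr0_norm // rhoE exprMn mulrA.
  apply: (@lt_le_trans _ _ (z0 ^+ S.+1)).
    by rewrite gtr_pMl ?exprn_gt0 //; lra.
  by apply: lerXn2r; rewrite ?nnegrE // ltW.
have := monic_gt0 (char_poly_monic H) noH; rewrite horner_char_poly.
set A := z0%:M - H => detA.
have uA : A \in unitmx by rewrite unitmxE unitfE lt0r_neq0.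
suff ge1 : 1 <= lam * (u^T *m (invmx A *m u)) 0 0.
  have [|z z0z rz] := @monic_root_above _ _ z0 (char_poly_monic (lam *: (u *m
      u^T) + H)).
    rewrite horner_char_poly.
    have -> : z0%:M - (lam *: (u *m u^T) + H) = A - (lam *: u) *m u^T.
      by rewrite -scalemxAl /A opprD addrA addrAC.
    rewrite det_sub_rank1 // mulr_ge0_le0 ?(ltW detA) //.
    by rewrite subr_le0 -mulmxA -scalemxAr -scalemxAr mxE.
  by exists z => //; rewrite eigenvalue_root_char.
set x := invmx A *m u.
have xE : z0 *: x = 1 *: u + H *m x.
  rewrite scale1r; apply/eqP; rewrite -subr_eq; apply/eqP.
  by rewrite -mul_scalar_mx -mulmxBl mulKVmx.
(* The expansion is finite, with a remainder containing [x] itself; hence the a priori bound on its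
   l1 norm [N] below. *)
have {}xE := neumann_expansion S.+1 (lt0r_neq0 z00) xE.
rewrite big_ord_recl /= expr0 mul1mx expr1 in xE.
pose N := \sum_j `|x j 0|; have N0 : 0 <= N by exact: sumr_ge0.
have l1u := sum_norm_unit_le u1.
have HS i j : `|(H ^+ S.+1) i j| <= rho ^+ S.+1 by apply: Hij; rewrite /= leqnn.
have r_half : 0 <= r <= 2^-1 by rewrite r0 /=; lra.
have geo := sum_geometric_le S r_half.
have z0X s : 0 < z0 ^+ s by rewrite exprn_gt0.
have rX s : rho ^+ s / z0 ^+ s = r ^+ s by rewrite -expr_div_n.
(* [N] occurs on both sides of the estimate drawn from the expansion; its coefficient on the right
   is at most 1/32 and is absorbed. *)
have Nle : N * z0 <= 4 * n%:R ^+ 2.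
  have xi i : `|x i 0| <= z0^-1 * (`|u i 0| + n%:R * (2 * r)) + r ^+ S.+1 * N.
    rewrite {1}xE mxE (le_trans (ler_normD _ _)) // lerD //.
      rewrite mxE (le_trans (ler_normD _ _)) // mulrDr lerD //.
        by rewrite mxE normrM div1r ger0_norm // invr_ge0 ltW.
      rewrite summxE (le_trans (ler_norm_sum _ _ _)) //.
      apply: (@le_trans _ _ (\sum_(s < S) z0^-1 * (n%:R * r ^+ s.+1))); last
          first.
        by rewrite -mulr_sumr ler_wpM2l ?invr_ge0 ?(ltW z00) // -mulr_sumr
            ler_wpM2l.
      apply: ler_sum => s _; rewrite mxE normrM ger0_norm ?divr_ge0 ?(ltW (z0X
          _)) //.
      rewrite div1r exprS invfM -mulrA ler_wpM2l ?invr_ge0 ?(ltW z00) //.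
      rewrite mulrC ler_pdivrMr // -rX mulrA divfK ?lt0r_neq0 // mulrC.
      apply: le_trans (norm_mulmx_col_le _ _ _) _.
        by move=> i' j'; apply: Hij; rewrite /= ltnW // ltnS.
      by rewrite ler_wpM2l // exprn_ge0.
    rewrite mxE normrM ger0_norm ?invr_ge0 ?(ltW (z0X _)) // -rX.
    rewrite mulrC ler_pdivrMr // mulrAC divfK ?lt0r_neq0 //.
    exact: norm_mulmx_col_le.
  have : N <= z0^-1 * (n%:R + n%:R * (n%:R * (2 * r))) + n%:R * r ^+ S.+1 * N.
    apply: (@le_trans _ _ (\sum_i (z0^-1 * (`|u i 0| + n%:R * (2 * r)) + r ^+
        S.+1 * N))).
      exact: ler_sum.
    rewrite big_split /= -mulr_sumr big_split /= !sumr_const card_ord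
      -[(n%:R * _) *+ n]mulr_natl -[(_ * N) *+ n]mulr_natl.
    by rewrite [n%:R * (r ^+ _ * N)]mulrA lerD2r ler_wpM2l ?invr_ge0 ?(ltW z00)
        // lerD2r.
  have zi : z0^-1 * z0 = 1 by rewrite mulVf ?lt0r_neq0.
  move=> /(ler_wpM2r (ltW z00)); rewrite mulrDl mulrAC zi mul1r.
  have : n%:R * r ^+ S.+1 * N * z0 <= 32^-1 * (N * z0).
    by rewrite -mulrA; apply: ler_wpM2r nrS; rewrite mulr_ge0 // ltW.
  have : n%:R * (n%:R * (2 * r)) <= n%:R ^+ 2.
    rewrite mulrA -expr2 ler_piMr ?sqr_ge0 //; lra.
  have : n%:R <= n%:R ^+ 2 :> R by rewrite -[leLHS]expr1 ler_weXn2l.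
  have : 0 <= N * z0 by rewrite mulr_ge0 // ltW.
  lra.
have uu : (u^T *m u) 0 0 = 1.
  by rewrite mxE -u1; apply: eq_bigr => i _; rewrite mxE expr2.
have -> : lam = 2 * z0 by rewrite /z0; field.
have xuE : (u^T *m x) 0 0 = z0^-1 +
    \sum_(s < S) (u^T *m (H ^+ s.+1 *m u)) 0 0 / z0 ^+ s.+2 +
    (u^T *m (H ^+ S.+1 *m x)) 0 0 / z0 ^+ S.+1.
  rewrite {1}xE !mulmxDr -!scalemxAr mxE [X in X + _]mxE.
  rewrite [X in X + _ + _]mxE uu mulr1 div1r; congr (_ + _ + _).
    rewrite mulmx_sumr summxE; apply: eq_bigr => s _.
    by rewrite -scalemxAr mxE div1r mulrC.
  by rewrite mxE mulrC.
have b1 : `|\sum_(s < S) (u^T *m (H ^+ s.+1 *m u)) 0 0 / z0 ^+ s.+2| <= z0^-1 *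
    (2 * r).
  apply: le_trans (ler_norm_sum _ _ _) _.
  apply: (@le_trans _ _ (\sum_(s < S) z0^-1 * r ^+ s.+1)); last first.
    by rewrite -mulr_sumr ler_wpM2l // invr_ge0 ltW.
  apply: ler_sum => s _; rewrite normrM normfV [`|z0 ^+ _|]ger0_norm ?(ltW (z0X
      _)) //.
  rewrite (exprS z0) invfM mulrCA ler_wpM2l ?invr_ge0 ?(ltW z00) // -rX.
  apply: ler_wpM2r; first by rewrite invr_ge0 (ltW (z0X _)).
  by apply: Hu; rewrite /= ltnS.
have b2 : `|(u^T *m (H ^+ S.+1 *m x)) 0 0 / z0 ^+ S.+1| <= r ^+ S.+1 * n%:R * N.
  rewrite normrM normfV [`|z0 ^+ _|]ger0_norm ?(ltW (z0X _)) // ler_pdivrMr //.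
  have -> : r ^+ S.+1 * n%:R * N * z0 ^+ S.+1 = rho ^+ S.+1 * n%:R * N.
    rewrite -rX; move: (rho ^+ _) (z0 ^+ _) (z0X S.+1) => p q q0; field.
    exact: lt0r_neq0.
  apply: le_trans (norm_bilinear_le _ _ HS) _.
  by rewrite ler_wpM2r // ler_wpM2l // exprn_ge0.
have b3 : r ^+ S.+1 * n%:R * N * z0 <= 4 * 32^-1.
  apply: (@le_trans _ _ (r ^+ S.+1 * n%:R * (4 * n%:R ^+ 2))).
    by rewrite -mulrA ler_wpM2l // mulr_ge0.
  have -> : r ^+ S.+1 * n%:R * (4 * n%:R ^+ 2) = 4 * (n%:R ^+ 3 * r ^+ S.+1) by
      ring.
  by rewrite ler_wpM2l.
have zi : z0^-1 * z0 = 1 by rewrite mulVf ?lt0r_neq0.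
set p := (X in z0^-1 + X + _) in xuE b1; set e := (X in _ + X) in xuE b2.
have {}b1 : `|p| * z0 <= 2 * r.
  by apply: le_trans (ler_wpM2r (ltW z00) b1) _; rewrite mulrAC zi mul1r.
have {}b2 : `|e| * z0 <= 4 * 32^-1.
  by apply: le_trans b3; rewrite ler_wpM2r // ltW.
have : - (`|p| * z0) <= p * z0 by rewrite -mulNr ler_wpM2r ?(ltW z00) // lerNl
    -normrN ler_norm.
have : - (`|e| * z0) <= e * z0 by rewrite -mulNr ler_wpM2r ?(ltW z00) // lerNl
    -normrN ler_norm.
(* The value is at least [2 * (1 - 2/50 - 4/32)], which exceeds 1. *)
rewrite xuE -mulrA [z0 * _]mulrC !mulrDl zi; lra.
Qed.

Local Open Scope classical_set_scope.
Local Open Scope ring_scope.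

(** * Linear forms of the complex eigenvector *)

(** The norm of [R[i]] takes values in [R[i]]; this conversion carries its inequalities over to the
    real-valued modulus. *)
Lemma normr_normc (R : rcfType) (x : R[i]) : `|x| = (Normc.normc x)%:C%C.
Proof. by []. Qed.

Lemma normc_sum_le (R : rcfType) (I : Type) (r : seq I) (p : pred I)
    (F : I -> R[i]) :
  Normc.normc (\sum_(i <- r | p i) F i) <= \sum_(i <- r | p i) Normc.normc (F
      i).
Proof.
rewrite -lecR rmorph_sum /= -normr_normc.
exact: ler_norm_sum.
Qed.

Lemma normc_real (R : rcfType) (x : R) : Normc.normc x%:C%C = `|x|.
Proof. by rewrite /Normc.normc /= expr0n addr0 sqrtr_sqr. Qed.

Lemma normcX (R : rcfType) (x : R[i]) k : Normc.normc (x ^+ k) = Normc.normc x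
    ^+ k.
Proof.
by elim: k => [|k IH]; rewrite ?expr0 ?Normc.normc1 // !exprS Normc.normcM IH.
Qed.

Lemma complexify_exp (R : realType) (n s : nat) (H : 'M[R]_n) :
  complexify (H ^+ s) = complexify H ^+ s.
Proof.
elim: s => [|s IH].
  by rewrite !expr0 /complexify map_mx1.
by rewrite !exprS -!mulmxE /complexify map_mxM -!/(complexify _) IH.
Qed.

Lemma sqr_norm_sum1 (R : realType) (n : nat) (v : 'cV[R]_n) :
  l2norm v = 1 -> \sum_i v i 0 ^+ 2 = 1.
Proof.
move=> v1; rewrite -[LHS]sqr_sqrtr ?sumr_ge0 // => [|i _]; last exact: sqr_ge0.
by rewrite -/(l2norm v) v1 expr1n.
Qed.

Lemma sqr_normC_sum1 (R : realType) (n : nat) (w : 'cV[R[i]]_n) :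
  l2normC w = 1 -> \sum_i Normc.normc (w i 0) ^+ 2 = 1.
Proof.
move=> w1; rewrite -[LHS]sqr_sqrtr ?sumr_ge0 // => [|i _]; last exact: sqr_ge0.
by rewrite -/(l2normC w) w1 expr1n.
Qed.

Lemma normc_ge0 (R : rcfType) (x : R[i]) : 0 <= Normc.normc x.
Proof. by rewrite -lecR -normr_normc normr_ge0. Qed.

(** The zeroth term of the Neumann expansion of [w] is exactly the multiple of [u] that is
    subtracted. With [r] the ratio of [rho] to [|lam| / 2], the terms with [s >= 1] cost [4 * r * V]
    and the remainder [r * V]. *)
Lemma eigenvector_linear_form (R : realType) (n S : nat) (H : 'M[R]_n)
    (a u : 'cV[R]_n) (lam rho V : R) (l : R[i]) (w : 'cV[R[i]]_n) :
  lam != 0 -> 0 <= rho -> rho / (`|lam| / 2) <= 50^-1 ->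
  n%:R ^+ 3 * (rho / (`|lam| / 2)) ^+ S <= 1 ->
  l2norm u = 1 -> l2norm a = 1 ->
  (forall s, (0 < s <= S)%N -> `|(a^T *m (H ^+ s *m u)) 0 0| <= V * rho ^+ s) ->
  (forall i j, `|(H ^+ S.+1) i j| <= rho ^+ S.+1) ->
  0 <= V -> 1 <= n%:R * V -> `|lam| / 2 <= Normc.normc l ->
  complexify (lam *: (u *m u^T) + H) *m w = l *: w -> l2normC w = 1 ->
  Normc.normc (((complexify a)^T *m
      (w - (((complexify u)^T *m w) 0 0 / (l / real_complex R lam))
            *: complexify u)) 0 0)
  <= 5 * (rho / (`|lam| / 2)) * V.
Proof.
move=> lam0 rho0 r50 nr /sqr_norm_sum1 u1 /sqr_norm_sum1 a1 Hau HS V0 nV zl Mw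
    /sqr_normC_sum1 w1.
set z0 := `|lam| / 2 in r50 nr zl *; set r := rho / z0 in r50 nr *.
have lamp : 0 < `|lam| by rewrite normr_gt0.
have z00 : 0 < z0 by rewrite divr_gt0.
have r0 : 0 <= r by rewrite divr_ge0 // ltW.
have l0 : 0 < Normc.normc l := lt_le_trans z00 zl.
have ln0 : l != 0 by apply: contraTneq l0 => ->; rewrite Normc.normc0 ltxx.
set beta := ((complexify u)^T *m w) 0 0.
set uC := complexify u in beta *; set aC := complexify a; set HC := complexify
    H.
have eig : l *: w = (real_complex R lam * beta) *: uC + HC *m w.
  rewrite -Mw /complexify map_mxD map_mxZ map_mxM -matrix.map_trmx mulmxDl;
      congr (_ + _).
  rewrite -scalemxAl -mulmxA -scalerA; congr (_ *: _).
  by rewrite [_ *m w]mx11_scalar mul_mx_scalar.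
have wE := neumann_expansion S.+1 ln0 eig.
have bilC s : (aC^T *m (HC ^+ s *m uC)) 0 0 = ((a^T *m (H ^+ s *m u)) 0 0)%:C%C.
  by rewrite /aC /HC /uC -complexify_exp /complexify matrix.map_trmx -!map_mxM
      mxE.
have expand : (aC^T *m (w - (beta / (l / real_complex R lam)) *: uC)) 0 0 =
    \sum_(s < S) (real_complex R lam * beta / l ^+ s.+2) *
        (aC^T *m (HC ^+ s.+1 *m uC)) 0 0 +
    (l ^+ S.+1)^-1 * (aC^T *m (HC ^+ S.+1 *m w)) 0 0.
  rewrite {1}wE big_ord_recl /= expr0 mul1mx expr1.
  have -> : beta / (l / real_complex R lam) = real_complex R lam * beta / l.
    by rewrite invfM invrK mulrA mulrAC [beta * _]mulrC.
  rewrite addrAC [_ *: uC + _]addrC addrK.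
  rewrite mulmxDr mxE mulmx_sumr summxE; congr (_ + _).
    by apply: eq_bigr => s _; rewrite -scalemxAr mxE.
  by rewrite -scalemxAr mxE.
have beta1 : Normc.normc beta <= 1.
  rewrite /beta mxE; apply: le_trans (normc_sum_le _ _ _) _.
  (* Both vectors being of norm 1, the inequality of arithmetic and geometric means does the work of
     Cauchy-Schwarz. *)
  apply: (@le_trans _ _ (\sum_i (u i 0 ^+ 2 + Normc.normc (w i 0) ^+ 2) / 2)).
    apply: ler_sum => i _; rewrite !mxE Normc.normcM normc_real -[u i 0 ^+
        2]real_normK ?num_real //.
    have := sqr_ge0 (`|u i 0| - Normc.normc (w i 0)); rewrite ler_pdivlMr //;
        nra.
  by rewrite -mulr_suml big_split /= u1 w1; lra.
have cl : Normc.normc (real_complex R lam * beta / l) <= 2.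
  rewrite !Normc.normcM Normc.normcV normc_real ler_pdivrMr //.
  have := normc_ge0 beta; move: zl; rewrite /z0; nra.
have lX s : 0 < Normc.normc l ^+ s by rewrite exprn_gt0.
have rl s : rho ^+ s / Normc.normc l ^+ s <= r ^+ s.
  rewrite -expr_div_n; apply: lerXn2r; rewrite ?nnegrE ?divr_ge0 ?(ltW l0) //.
  by rewrite ler_wpM2l // lef_pV2.
have r_half : 0 <= r <= 2^-1 by rewrite r0 /=; lra.
have geo := sum_geometric_le S r_half.
have b1 : Normc.normc (\sum_(s < S) (real_complex R lam * beta / l ^+ s.+2) *
        (aC^T *m (HC ^+ s.+1 *m uC)) 0 0) <= 2 * V * (2 * r).
  apply: le_trans (normc_sum_le _ _ _) _.
  apply: (@le_trans _ _ (\sum_(s < S) 2 * V * r ^+ s.+1)); last first.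
    by rewrite -mulr_sumr ler_wpM2l // mulr_ge0.
  apply: ler_sum => s _; rewrite bilC exprS invfM mulrA Normc.normcM normc_real.
  rewrite Normc.normcM Normc.normcV normcX -[leRHS]mulrA -[leLHS]mulrA.
  apply: ler_pM => //; rewrite ?normc_ge0 ?mulr_ge0 ?invr_ge0 ?(ltW (lX _)) //.
  rewrite mulrC; apply: (@le_trans _ _ (V * rho ^+ s.+1 / Normc.normc l ^+
      s.+1)).
    by rewrite ler_wpM2r ?invr_ge0 ?(ltW (lX _)) // Hau /=.
  by rewrite -mulrA ler_wpM2l.
have b2 : Normc.normc ((l ^+ S.+1)^-1 * (aC^T *m (HC ^+ S.+1 *m w)) 0 0) <=
    n%:R ^+ 2 * r ^+ S.+1.
  rewrite Normc.normcM Normc.normcV normcX mulrC.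
  have wl1 : \sum_j Normc.normc (w j 0) <= n%:R.
    pose v : 'cV[R]_n := \col_j Normc.normc (w j 0).
    have := @sum_norm_unit_le _ _ v; rewrite -w1.
    under eq_bigr do rewrite mxE.
    move=> /(_ erefl); under eq_bigr do rewrite mxE ger0_norm ?normc_ge0 //.
    by [].
  have al1 := sum_norm_unit_le a1.
  apply: (@le_trans _ _ (rho ^+ S.+1 * n%:R * n%:R / Normc.normc l ^+ S.+1)).
    rewrite ler_wpM2r ?invr_ge0 ?(ltW (lX _)) // -lecR -normr_normc.
    have HSC i j : `|(HC ^+ S.+1) i j| <= (rho ^+ S.+1)%:C%C.
      by rewrite /HC -complexify_exp mxE normr_normc normc_real lecR.
    apply: le_trans (norm_bilinear_le _ _ HSC) _.
    under eq_bigr do rewrite /aC mxE normr_normc normc_real.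
    under [X in _ * X]eq_bigr do rewrite normr_normc.
    rewrite -!rmorph_sum -!rmorphM lecR.
    apply: ler_pM; rewrite ?mulr_ge0 ?exprn_ge0 ?sumr_ge0 //.
      by move=> i _; apply: normc_ge0.
    by rewrite ler_wpM2l ?exprn_ge0.
  have -> : rho ^+ S.+1 * n%:R * n%:R / Normc.normc l ^+ S.+1 =
      n%:R ^+ 2 * (rho ^+ S.+1 / Normc.normc l ^+ S.+1) by ring.
  by rewrite ler_wpM2l ?sqr_ge0.
rewrite expand; apply: le_trans (le_normcD _ _) _.
apply: le_trans (lerD b1 b2) _.
(* The remainder carries no factor [V]; one is inserted through [1 <= n%:R * V], and the resulting
   [n%:R ^+ 3 * r ^+ S] is at most 1. *)
have : n%:R ^+ 2 * r ^+ S.+1 <= r * V.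
  rewrite (exprS r) mulrCA ler_wpM2l //.
  have rS0 : 0 <= n%:R ^+ 2 * r ^+ S by rewrite mulr_ge0 ?exprn_ge0 ?sqr_ge0.
  apply: le_trans (ler_peMr rS0 nV) _.
  have -> : n%:R ^+ 2 * r ^+ S * (n%:R * V) = n%:R ^+ 3 * r ^+ S * V by ring.
  by rewrite ler_piMl.
lra.
Qed.

(** * Moments of the truncated noise *)

(** This class is stable under sums, products and composition, and its members are integrable for a
    probability, so linearity of the integral applies to all the polynomials in truncated entries
    below. *)
Definition bounded_measurable (d : measure_display) (T : measurableType d)
    (R : realType) (f : T -> R) : Prop :=
  measurable_fun [set: T] f /\ exists M : R, forall w, `|f w| <= M.

Lemma bounded_measurable_cst (d : measure_display) (T : measurableType d)
    (R : realType) (c : R) : bounded_measurable (fun _ : T => c).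
Proof. by split; [exact: measurable_cst | exists `|c|]. Qed.

Lemma bounded_measurableD (d : measure_display) (T : measurableType d)
    (R : realType) (f g : T -> R) :
  bounded_measurable f -> bounded_measurable g ->
  bounded_measurable (fun w => f w + g w).
Proof.
move=> [mf [M fM]] [mg [N gN]]; split; first exact: measurable_funD.
by exists (M + N) => w; apply: (le_trans (ler_normD _ _)); apply: lerD.
Qed.

Lemma bounded_measurableM (d : measure_display) (T : measurableType d)
    (R : realType) (f g : T -> R) :
  bounded_measurable f -> bounded_measurable g ->
  bounded_measurable (fun w => f w * g w).
Proof.
move=> [mf [M fM]] [mg [N gN]]; split; first exact: measurable_funM.
by exists (M * N) => w; rewrite normrM; apply: ler_pM.
Qed.

Lemma bounded_measurable_sum (d : measure_display) (T : measurableType d)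
    (R : realType) (I : Type) (r : seq I) (p : pred I) (f : I -> T -> R) :
  (forall i, bounded_measurable (f i)) ->
  bounded_measurable (fun w => \sum_(i <- r | p i) f i w).
Proof.
move=> bf; elim: r => [|i r IH].
  under eq_fun do rewrite big_nil; exact: bounded_measurable_cst.
under eq_fun do rewrite big_cons.
by case: (p i) => //; apply: bounded_measurableD.
Qed.

Lemma bounded_measurable_prod (d : measure_display) (T : measurableType d)
    (R : realType) (I : Type) (r : seq I) (p : pred I) (f : I -> T -> R) :
  (forall i, bounded_measurable (f i)) ->
  bounded_measurable (fun w => \prod_(i <- r | p i) f i w).
Proof.
move=> bf; elim: r => [|i r IH].
  under eq_fun do rewrite big_nil; exact: bounded_measurable_cst.
under eq_fun do rewrite big_cons.
by case: (p i) => //; apply: bounded_measurableM.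
Qed.

Lemma bounded_measurableX (d : measure_display) (T : measurableType d)
    (R : realType) (f : T -> R) k :
  bounded_measurable f -> bounded_measurable (fun w => f w ^+ k).
Proof.
move=> bf; elim: k => [|k IH]; first exact: bounded_measurable_cst.
by under eq_fun do rewrite exprS; apply: bounded_measurableM.
Qed.

Lemma bounded_measurable_indic (d : measure_display) (T : measurableType d)
    (R : realType) (A : set T) :
  measurable A -> bounded_measurable (\1_A : T -> R).
Proof.
move=> mA; split; first exact: measurable_indic.
by exists 1 => w; rewrite indicE; case: (_ \in _); rewrite /= ?normr1 ?normr0.
Qed.

Lemma bounded_measurable_comp (d d' : measure_display) (T : measurableType d)
    (T' : measurableType d') (R : realType) (X : T -> T') (f : T' -> R) :
  measurable_fun [set: T] X -> bounded_measurable f ->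
  bounded_measurable (f \o X).
Proof.
move=> mX [mf [M fM]]; split; first exact: measurableT_comp.
by exists M => w; apply: fM.
Qed.

Lemma bounded_measurable_integrable (d : measure_display) (T : measurableType d)
    (R : realType) (P : probability T R) (f : T -> R) :
  bounded_measurable f -> P.-integrable setT (EFin \o f).
Proof.
move=> [mf [M fM]]; apply: measurable_bounded_integrable => //.
  by rewrite [X in (X < _)%E](probability_setT P) ltry.
exists M; split; first exact: num_real.
by move=> x Mx w _; apply: le_trans (fM w) (ltW Mx).
Qed.

Lemma Rintegral_sum (d : measure_display) (T : measurableType d)
    (R : realType) (P : probability T R) (I : Type) (r : seq I) (p : pred I)
    (f : I -> T -> R) :
  (forall i, bounded_measurable (f i)) ->
  \int[P]_w (\sum_(i <- r | p i) f i w) = \sum_(i <- r | p i) \int[P]_w f i w.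
Proof.
move=> bf; elim: r => [|i r IH].
  under eq_Rintegral do rewrite big_nil.
  by rewrite Rintegral_cst // mul0r big_nil.
under eq_Rintegral do rewrite big_cons.
rewrite big_cons; case: (p i) => //; rewrite RintegralD ?IH //.
  exact: bounded_measurable_integrable.
exact/bounded_measurable_integrable/bounded_measurable_sum.
Qed.

Lemma Rintegral_probability_cst (d : measure_display) (T : measurableType d)
    (R : realType) (P : probability T R) (c : R) : \int[P]_w c = c.
Proof. by rewrite Rintegral_cst // [X in fine X](probability_setT P) mulr1. Qed.

Lemma Rintegral_indic (d : measure_display) (T : measurableType d)
    (R : realType) (P : probability T R) (A : set T) :
  measurable A -> \int[P]_w \1_A w = fine (P A).
Proof. by move=> mA; rewrite /Rintegral integral_indic // setIT. Qed.

Lemma le_norm_Rintegral_diff (d : measure_display) (T : measurableType d)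
    (R : realType) (P : probability T R) (f g : T -> R) (e : R) :
  bounded_measurable f -> bounded_measurable g ->
  (forall w, `|f w - g w| <= e) -> `|\int[P]_w f w - \int[P]_w g w| <= e.
Proof.
move=> bf bg fg; rewrite -RintegralB //; try exact:
    bounded_measurable_integrable.
have bB : bounded_measurable (fun w => f w - g w).
  apply: bounded_measurableD => //.
  have -> : (fun w => - g w) = (fun w => -1 * g w) by apply/funext => w;
      rewrite mulN1r.
  exact/bounded_measurableM/bg/bounded_measurable_cst.
apply: le_trans (le_normr_Rintegral measurableT (bounded_measurable_integrable
    P bB)) _.
rewrite -[leRHS](Rintegral_probability_cst P); apply: le_Rintegral => //.
  exact/integrable_norm/bounded_measurable_integrable.
exact/bounded_measurable_integrable/bounded_measurable_cst.
Qed.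

(** * Independence and expectations of products *)

(** This is [f] rounded down to a multiple of [e], as a finite combination of indicators. The index
    [k] stands for the level [k - N], which runs from [-N] to [N] inclusive. *)
Definition staircase (R : realType) (d : measure_display)
    (T : measurableType d) (f : T -> R) (N : nat) (e : R) (x : T) : R :=
  \sum_(k < N.*2.+1) (k%:R - N%:R) * e *
     \1_(f @^-1` [set y | (k%:R - N%:R) * e <= y < (k%:R - N%:R) * e + e]) x.

Lemma staircase_close (R : realType) (d : measure_display)
    (T : measurableType d) (f : T -> R) (N : nat) (e : R) :
  0 < e -> (forall x, `|f x| <= N%:R * e) ->
  forall x, `|f x - staircase f N e x| <= e.
Proof.
move=> e0 fN x; pose z := Num.floor (f x / e).
have /andP[fz1 fz2] : z%:~R * e <= f x < z%:~R * e + e.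
  have /andP[] := floor_itv (f x / e); rewrite -/z intrD1.
  by rewrite ler_pdivlMr // ltr_pdivrMr // mulrDl mul1r => -> ->.
have := fN x; rewrite ler_norml => /andP[f1 f2].
have zN : - N%:Z <= z.
  by rewrite /z floor_ge_int mulrNz ler_pdivlMr // mulNr.
have zN' : z <= N%:Z.
  by rewrite -(ler_int R) -(ler_pM2r e0) (le_trans fz1).
have zN0 : 0 <= z + N%:Z by lia.
case zE : (z + N%:Z) zN0 => [k0|//] _.
have kP : (k0 < N.*2.+1)%N by lia.
have kE : (k0%:R : R) - N%:R = z%:~R.
  by rewrite (_ : z = k0%:Z - N%:Z) ?intrB //; lia.
rewrite /staircase (bigD1 (Ordinal kP)) //= big1 ?addr0 => [|k kne].
  rewrite kE indicE mem_set; last by rewrite /= fz1 fz2.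
  by rewrite mulr1 ler_norml; lra.
rewrite indicE memNset ?mulr0 // => /= /andP[k1 k2].
move/negP: kne; apply; apply/eqP/val_inj => /=.
have : (k%:Z - N%:Z)%:~R < (z + 1)%:~R :> R.
  by rewrite -(ltr_pM2r e0) intrB intrD1 [(_ + 1) * e]mulrDl mul1r; lra.
have : z%:~R < (k%:Z - N%:Z + 1)%:~R :> R.
  by rewrite -(ltr_pM2r e0) intrD1 intrB [(_ + 1) * e]mulrDl mul1r; lra.
rewrite !ltr_int; lia.
Qed.

(** The identity passes from indicators to staircases by linearity, and then to [g] by uniform
    approximation, with error at most [e * (MY + |c|)]. *)
Lemma Rintegral_indep_step (d : measure_display) (T : measurableType d)
    (R : realType) (P : probability T R) (X Y : T -> R) (c : R) :
  measurable_fun [set: T] X -> bounded_measurable Y ->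
  (forall A, measurable A ->
    \int[P]_w (\1_A (X w) * Y w) = \int[P]_w \1_A (X w) * c) ->
  forall g : R -> R, bounded_measurable g ->
  \int[P]_w (g (X w) * Y w) = \int[P]_w g (X w) * c.
Proof.
move=> mX bY indep g bg.
have [MY YM] := bY.2; have [M gM] := bg.2.
have MY0 : 0 <= MY := le_trans (normr_ge0 _) (YM point).
suff close e : 0 < e ->
    `|\int[P]_w (g (X w) * Y w) - \int[P]_w g (X w) * c| <= e * (MY + `|c|).
  apply/eqP; rewrite -subr_eq0 -normr_le0; apply/ler_addgt0Pl => e e0.
  rewrite addr0; have K0 : 0 < MY + `|c| + 1 by rewrite ltr_wpDl // addr_ge0.
  apply: le_trans (close (e / (MY + `|c| + 1)) (divr_gt0 e0 K0)) _.
  rewrite mulrAC ler_pdivrMr // ler_wpM2l ?ltW //; lra.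
move=> e0.
pose N := (Num.trunc (M / e)).+1.
have MN x : `|g x| <= N%:R * e.
  by apply: (le_trans (gM x)); rewrite -ler_pdivrMr // ltW // truncnS_gt.
set s := staircase g N e.
have close := staircase_close e0 MN; rewrite -/s in close.
have mS k : measurable (g @^-1` [set y | (k%:R - N%:R) * e <= y < (k%:R - N%:R)
    * e + e]).
  rewrite -[X in measurable X]setTI; apply: bg.1 => //.
  have -> : [set y | (k%:R - N%:R) * e <= y < (k%:R - N%:R) * e + e] =
      `[(k%:R - N%:R) * e, (k%:R - N%:R) * e + e[%classic.
    by apply/seteqP; split => y /=; rewrite in_itv.
  exact: measurable_itv.
have bI A : measurable A -> bounded_measurable (fun w => \1_A (X w) : R).
  by move=> mA; apply: (bounded_measurable_comp mX); apply:
      bounded_measurable_indic.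
have bgX : bounded_measurable (fun w => g (X w)) by exact:
    bounded_measurable_comp mX bg.
have bk (k : 'I_N.*2.+1) : bounded_measurable (fun w => (k%:R - N%:R) * e *
    \1_(g @^-1` [set y | (k%:R - N%:R) * e <= y < (k%:R - N%:R) * e + e]) (X
        w)).
  by apply: bounded_measurableM; [exact: bounded_measurable_cst|exact: bI (mS
      _)].
have bs : bounded_measurable (fun w => s (X w)).
  exact: bounded_measurable_sum.
have sE : \int[P]_w (s (X w) * Y w) = \int[P]_w s (X w) * c.
  under eq_Rintegral do rewrite /s /staircase mulr_suml.
  rewrite Rintegral_sum => [|k]; last exact: bounded_measurableM.
  rewrite [in RHS]Rintegral_sum // mulr_suml; apply: eq_bigr => k _.
  under eq_Rintegral do rewrite -(mulrA _ _ (Y _)).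
  rewrite RintegralZl //; last first.
    by apply: bounded_measurable_integrable; apply: bounded_measurableM (bI _
        (mS _)) bY.
  rewrite RintegralZl //; last exact: bounded_measurable_integrable (bI _ (mS
      _)).
  by rewrite indep // mulrA.
have h1 : `|\int[P]_w (g (X w) * Y w) - \int[P]_w (s (X w) * Y w)| <= e * MY.
  apply: le_norm_Rintegral_diff => [||w]; try exact: bounded_measurableM.
  by rewrite -mulrBl normrM ler_pM.
have h2 : `|\int[P]_w g (X w) - \int[P]_w s (X w)| <= e.
  exact: le_norm_Rintegral_diff.
rewrite mulrDr (le_trans (ler_distD (\int[P]_w (s (X w) * Y w)) _ _)) // lerD
    //.
by rewrite sE -mulrBl normrM distrC ler_wpM2r.
Qed.

(** Induction on a list [s] outside which all factors are indicators. For empty [s] the claim is the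
    independence of events; otherwise the factor at [i0] is replaced by an arbitrary indicator, and
    the induction hypothesis feeds [Rintegral_indep_step]. *)
Lemma Rintegral_prod_indep (d : measure_display) (T : measurableType d)
    (R : realType) (P : probability T R) (I : finType) (X : I -> {RV P >-> R})
    (g : I -> R -> R) :
  mutually_independent X -> (forall i, bounded_measurable (g i)) ->
  \int[P]_w (\prod_i g i (X i w)) = \prod_i \int[P]_w g i (X i w).
Proof.
move=> indep bg.
have mX i : measurable_fun [set: T] (X i) by exact: measurable_funPT.
suff gen (s : seq I) (h : I -> R -> R) : (forall i, bounded_measurable (h i)) ->
    (forall i, i \notin s -> exists2 A, measurable A & h i = \1_A) ->
    \int[P]_w (\prod_i h i (X i w)) = \prod_i \int[P]_w h i (X i w).
  by apply: (gen (enum I)) => // i; rewrite mem_enum.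
elim: s h => [|i0 s IH] h bh ind.
  have /choice[A hA] : forall i, exists A : set R, measurable A /\ h i = \1_A.
    by move=> i; have [A mA eA] := ind i isT; exists A.
  have mpre i : measurable (X i @^-1` A i).
    by rewrite -[X in measurable X]setTI; apply: mX => //; case: (hA i).
  have hE i w : h i (X i w) = \1_(X i @^-1` A i) w.
    by rewrite (hA i).2 !indicE; congr (_%:R); apply/idP/idP; rewrite !inE.
  transitivity (\int[P]_w (\1_(\bigcap_(i in [set` [set: I]%SET]) X i @^-1` A
      i) w : R)).
    apply: eq_Rintegral => w _; rewrite indicE.
    case: (boolP (w \in _)) => [/set_mem wA|wA].
      by rewrite big1 // => i _; rewrite hE indicE mem_set //; apply: wA;
          rewrite /= inE.
    suff [i wi] : exists i, h i (X i w) = 0 by rewrite (bigD1 i) //= wi mul0r.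
    apply: contrapT => /forallNP none; move/negP: wA; apply; apply/mem_set => i
        _ /=.
    have := none i; rewrite hE indicE; case: (boolP (w \in _)) => [/set_mem
        //|_ []//].
  rewrite Rintegral_indic; last by apply: fin_bigcap_measurable.
  rewrite indep; last by move=> i; case: (hA i).
  under [RHS]eq_bigr => i _.
    under eq_Rintegral do rewrite hE.
    rewrite Rintegral_indic //.
    over.
  rewrite (eq_bigr (fun i => (fine (P (X i @^-1` A i)))%:E)) => [|i _]; last
      first.
    by rewrite fineK ?fin_num_measure.
  by rewrite prodEFin /=; apply: eq_bigl => i; rewrite inE.
have bhX i : bounded_measurable (fun w => h i (X i w)).
  exact: bounded_measurable_comp (mX i) (bh i).
rewrite [RHS](bigD1 i0) //=.
under eq_Rintegral do rewrite (bigD1 i0) //=.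
apply: (Rintegral_indep_step (mX i0)) => //; first exact:
    bounded_measurable_prod.
move=> A mA; pose h' i := if i == i0 then \1_A else h i.
have h'E i : i != i0 -> h' i = h i by move=> /negPf ne; rewrite /h' ne.
transitivity (\int[P]_w (\prod_i h' i (X i w))).
  apply: eq_Rintegral => w _; rewrite [RHS](bigD1 i0) //= {1}/h' eqxx.
  by congr (_ * _); apply: eq_bigr => i /h'E ->.
rewrite IH; first last.
- move=> i; rewrite /h'; case: eqP => [_ _|/eqP ne]; first by exists A.
  by move=> nis; apply: ind; rewrite inE negb_or ne.
- by move=> i; rewrite /h'; case: eqP => // _; apply: bounded_measurable_indic.
rewrite (bigD1 i0) //= {1}/h' eqxx; congr (_ * _).
by apply: eq_bigr => i /h'E ->.
Qed.

(** * Truncated entries and moments of bilinear forms *)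

Definition truncate (R : realType) (B x : R) : R := if `|x| <= B then x else 0.

Lemma le_truncate (R : realType) (B x : R) : 0 <= B -> `|truncate B x| <= B.
Proof. by move=> B0; rewrite /truncate; case: ifP => //; rewrite normr0. Qed.

Lemma truncateN (R : realType) (B x : R) : truncate B (- x) = - truncate B x.
Proof. by rewrite /truncate normrN; case: ifP; rewrite ?oppr0. Qed.

Lemma bounded_measurable_truncate (R : realType) (B : R) :
  0 <= B -> bounded_measurable (truncate B).
Proof.
move=> B0; split; last by exists B => x; apply: le_truncate.
apply: measurable_fun_if => //.
  apply: measurable_fun_ler => //.
Qed.

Lemma Rintegral_symmetric (d : measure_display) (T : measurableType d)
    (R : realType) (P : probability T R) (X : {RV P >-> R}) (g : R -> R) :
  symmetric_distribution X -> bounded_measurable g ->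
  \int[P]_w g (X w) = \int[P]_w g (- X w).
Proof.
move=> symX bg; rewrite /Rintegral; congr fine.
have mX : measurable_fun [set: T] X by exact: measurable_funPT.
have mNX : measurable_fun [set: T] (fun w => - X w) by exact: measurable_funN.
have mEg : measurable_fun setT (EFin \o g) by apply/measurable_EFinP; exact:
    bg.1.
transitivity (\int[pushforward P X]_y (EFin \o g) y)%E.
  rewrite integral_pushforward // preimage_setT.
  by apply: bounded_measurable_integrable (bounded_measurable_comp mX bg).
transitivity (\int[pushforward P (fun w => (- X w)%R)]_y (EFin \o g) y)%E; last
    first.
  rewrite integral_pushforward // preimage_setT.
  by apply: bounded_measurable_integrable (bounded_measurable_comp mNX bg).
apply: eq_measure_integral => A mA _; exact: symX.
Qed.

(** Both noise alternatives keep the mean zero: a bounded entry is almost surely unchanged, and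
    truncation is odd, so for a symmetric entry the integral equals its own opposite. *)
Lemma Rintegral_truncate0 (d : measure_display) (T : measurableType d)
    (R : realType) (P : probability T R) (B : R) (X : {RV P >-> R}) :
  0 <= B -> ('E_P[X] = 0)%E ->
  {ae P, forall w, (`|X w| <= B)%R} \/ symmetric_distribution X ->
  \int[P]_w truncate B (X w) = 0.
Proof.
move=> B0 EX [aeB|symX]; last first.
  have bt := bounded_measurable_truncate B0.
  have := Rintegral_symmetric symX bt.
  under [X in _ = X -> _]eq_Rintegral do rewrite truncateN -mulN1r.
  rewrite RintegralZl //; last first.
    apply: bounded_measurable_integrable (bounded_measurable_comp _ bt).
    exact: measurable_funPT.
  lra.
have mX : measurable_fun [set: T] X by exact: measurable_funPT.
rewrite /Rintegral (ae_eq_integral (EFin \o X)) //.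
- by move: EX; rewrite unlock => /= ->.
- apply/measurable_EFinP/measurableT_comp => //.
  exact: (bounded_measurable_truncate B0).1.
- exact/measurable_EFinP.
- by apply: filterS aeB => w wB _ /=; rewrite /truncate wB.
Qed.

Lemma Rintegral_truncate_sqr (d : measure_display) (T : measurableType d)
    (R : realType) (P : probability T R) (B sigma : R) (X : {RV P >-> R}) :
  0 <= B -> ('E_P[X] = 0)%E -> ('V_P[X] <= (sigma ^+ 2)%:E)%E ->
  \int[P]_w truncate B (X w) ^+ 2 <= sigma ^+ 2.
Proof.
move=> B0 EX VX.
have mX : measurable_fun [set: T] X by exact: measurable_funPT.
have bt := bounded_measurableX 2 (bounded_measurable_comp mX
    (bounded_measurable_truncate B0)).
have fin := integrable_fin_num measurableT (bounded_measurable_integrable P bt).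
rewrite -lee_fin /Rintegral fineK //; apply: le_trans VX.
rewrite /variance unlock EX /= unlock; apply: ge0_le_integral => //.
- by move=> w _; rewrite lee_fin sqr_ge0.
- exact/measurable_EFinP/bt.1.
- apply/measurable_EFinP/measurable_funM; apply: measurable_funB => //.
- move=> w _; rewrite lee_fin [leRHS](_ : _ = X w ^+ 2) /truncate; last first.
    by rewrite expr2 -[in RHS](subr0 (X w)).
  by case: ifP => // _; rewrite expr0n /= sqr_ge0.
Qed.

(** Taking out [B ^+ (k - 2)] leaves a second moment. In this form the powers of [B] multiply to one
    power per edge position, leaving a factor [sigma ^+ 2 / B ^+ 2] per distinct edge. *)
Lemma truncate_moment (d : measure_display) (T : measurableType d)
    (R : realType) (P : probability T R) (B sigma : R) (X : {RV P >-> R}) k :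
  0 < B -> ('E_P[X] = 0)%E -> ('V_P[X] <= (sigma ^+ 2)%:E)%E -> (1 < k)%N ->
  `|\int[P]_w truncate B (X w) ^+ k| <= sigma ^+ 2 / B ^+ 2 * B ^+ k.
Proof.
move=> B0 EX VX k1; have := ltW B0 => B0'.
have mX : measurable_fun [set: T] X by exact: measurable_funPT.
have bt j := bounded_measurableX j (bounded_measurable_comp mX
    (bounded_measurable_truncate B0')).
apply: le_trans (le_normr_Rintegral measurableT (bounded_measurable_integrable
    P (bt k))) _.
have -> : sigma ^+ 2 / B ^+ 2 * B ^+ k = B ^+ (k - 2) * sigma ^+ 2.
  rewrite -[in LHS](subnK k1) exprD; field; exact: lt0r_neq0.
apply: le_trans (ler_wpM2l _ (Rintegral_truncate_sqr B0' EX VX)); last exact: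
    exprn_ge0.
have bi := bounded_measurable_integrable P.
rewrite -RintegralZl //; last exact: bi (bt 2).
apply: le_Rintegral => //.
- by apply: integrable_norm; apply: bi.
- apply: (bi (fun w => B ^+ (k - 2) * truncate B (X w) ^+ 2)).
  by apply: bounded_measurableM (bt 2); exact: bounded_measurable_cst.
- move=> w _; rewrite normrX -{1}(subnK k1) exprD ler_pM ?exprn_ge0 //.
    by apply: lerXn2r; rewrite ?nnegrE // le_truncate.
  by rewrite -normrX ger0_norm // sqr_ge0.
Qed.

Lemma prod_fibres (R : comPzSemiRingType) (I J : finType) (e : J -> I)
    (F : I -> R) :
  \prod_j F (e j) = \prod_i F i ^+ #|[pred j | e j == i]|.
Proof.
rewrite (partition_big e predT) //=; apply: eq_bigr => i _.
by rewrite -prodr_const; apply: eq_bigr => j /eqP ->.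
Qed.

(** Independence splits the integral into one factor per matrix entry, raised to its multiplicity.
    Multiplicity 1 gives zero by centering, and higher multiplicities are bounded by
    [truncate_moment]. *)
Lemma Rintegral_edges (d : measure_display) (T : measurableType d)
    (R : realType) (P : probability T R) (cb sigma B : R) (n : nat)
    (H : 'I_n -> 'I_n -> {RV P >-> R}) (J : finType) (e : J -> 'I_n * 'I_n) :
  0 < B -> noise_assumption cb sigma B H ->
  `|\int[P]_w (\prod_j truncate B (H (e j).1 (e j).2 w))| <=
  (if all_repeated e then (sigma ^+ 2 / B ^+ 2) ^+ #|[set e j | j : J]| else 0)
    * B ^+ #|J|.
Proof.
move=> B0 noise; have B0' := ltW B0; set nu := sigma ^+ 2 / B ^+ 2.
have nu0 : 0 <= nu by rewrite divr_ge0 ?sqr_ge0.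
pose k i := #|[pred j | e j == i]|.
have -> : \int[P]_w (\prod_j truncate B (H (e j).1 (e j).2 w)) =
    \prod_i \int[P]_w truncate B (H i.1 i.2 w) ^+ k i.
  rewrite -(Rintegral_prod_indep (X := fun i => H i.1 i.2)
             (g := fun i x => truncate B x ^+ k i)).
  - by apply: eq_Rintegral => w _; rewrite (prod_fibres e (fun i => truncate B
      (H i.1 i.2 w))).
  - exact: noise_independent noise.
  - by move=> i; apply/bounded_measurableX/bounded_measurable_truncate.
rewrite normr_prod; case: ifP => [/forallP rep|]; last first.
  move=> /negbT; rewrite negb_forall => /existsP[j]; rewrite negb_exists =>
      /forallP uniq.
  rewrite mul0r (bigD1 (e j)) //= (_ : k (e j) = 1%N).
    under [X in `|X|]eq_Rintegral do rewrite expr1.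
    rewrite (Rintegral_truncate0 B0' (noise_centered noise _ _)) ?normr0 ?mul0r
        //.
    by case: (noise_tail noise (e j).1 (e j).2) => [|[]]; [left|right].
  rewrite /k (eq_card (B := pred1 j)) ?card1 // => j'; rewrite !inE.
  by have := uniq j'; rewrite negb_and negbK; case: (j' =P j) => [-> _|_ /negPf
      //]; rewrite eqxx.
have -> : nu ^+ #|[set e j | j : J]| * B ^+ #|J| =
    \prod_i ((if i \in [set e j | j : J] then nu else 1) * B ^+ k i).
  by rewrite big_split /= -prod_fibres prodr_const -big_mkcond /= prodr_const.
apply: ler_prod => -[i1 i2] _; rewrite normr_ge0 /=; set i := (i1, i2).
case: (boolP (i \in _)) => [/imsetP[j _ ij]|iN].
  apply: truncate_moment => //; [exact: (noise_centered noise)|exact: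
      (noise_variance noise)|].
  have /existsP[j' /andP[ne /eqP e']] := rep j.
  by apply/card_gt1P; exists j', j; rewrite !inE e' -ij eqxx.
rewrite (_ : k i = 0%N).
  under eq_Rintegral do rewrite expr0.
  by rewrite Rintegral_probability_cst normr1 expr0 mulr1.
by apply: eq_card0 => j; rewrite !inE; apply: contraNF iN => /eqP <-; apply:
    imset_f.
Qed.

Definition truncated_noise (d : measure_display) (T : measurableType d)
    (R : realType) (P : probability T R) (B : R) (n : nat)
    (H : 'I_n -> 'I_n -> {RV P >-> R}) (w : T) : 'M[R]_n :=
  \matrix_(i, j) truncate B (H i j w).

(** The two vectors act differently: [v] is bounded entrywise, each walk giving a factor [V],
    whereas [a] is bounded only in l2 and is kept as the weight of the starting points. *)
Lemma bilinear_moment (d : measure_display) (T : measurableType d)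
    (R : realType) (P : probability T R) (cb sigma B : R) (n : nat)
    (H : 'I_n -> 'I_n -> {RV P >-> R}) (a v : 'cV[R]_n) (V kappa : R)
    (q s : nat) :
  0 < B -> noise_assumption cb sigma B H -> (0 < n)%N -> (0 < s)%N ->
  \sum_i a i 0 ^+ 2 <= 1 -> 0 <= V -> (forall i, `|v i 0| <= V) ->
  0 < kappa -> (q * s)%:R <= kappa ->
  n%:R * (sigma ^+ 2 / B ^+ 2) * (q * s)%:R <= kappa ^+ 2 ->
  bounded_measurable
    (fun w => (a^T *m (truncated_noise B H w ^+ s *m v)) 0 0) /\
  \int[P]_w ((a^T *m (truncated_noise B H w ^+ s *m v)) 0 0 ^+ q) <=
    V ^+ q * (2 * kappa * B) ^+ (q * s).
Proof.
move=> B0 noise n0 s0 a1 V0 vV k0 mk nmk; have B0' := ltW B0.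
have bt i j : bounded_measurable (fun w => truncate B (H i j w)).
  by apply: bounded_measurable_comp (measurable_funPT _)
      (bounded_measurable_truncate B0').
split.
  under eq_fun do rewrite bilinear_walks.
  apply: bounded_measurable_sum => x; apply: bounded_measurableM; last exact:
      bounded_measurable_cst.
  apply: bounded_measurableM; first exact: bounded_measurable_cst.
  apply: bounded_measurable_prod => t.
  by under eq_fun do rewrite mxE.
have bterm (X : walk_family n q s) : bounded_measurable
    (fun w => \prod_j truncate B (H (edge X j).1 (edge X j).2 w)).
  exact: bounded_measurable_prod.
under eq_Rintegral do rewrite bilinear_exp_walks.
under eq_Rintegral => w _.
  under eq_bigr => X _.
    under [X in _ * X]eq_bigr do rewrite mxE.
    over.
  over.
rewrite Rintegral_sum => [|X]; last first.
  by apply: bounded_measurableM => //; exact: bounded_measurable_cst.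
pose alpha i := `|a i 0|.
have alpha01 i : 0 <= alpha i <= 1.
  rewrite /alpha normr_ge0 -(@ler_pXn2r _ 2) ?nnegrE // expr1n real_normK
      ?num_real //.
  by rewrite (le_trans _ a1) // (bigD1 i) //= lerDl sumr_ge0 // => j _; rewrite
      sqr_ge0.
have alpha1 : \sum_i alpha i ^+ 2 <= 1.
  by under eq_bigr do rewrite real_normK ?num_real //.
pose p (X : walk_family n q s) := #|[set edge X j | j : 'I_q * 'I_s]|.
set nu := sigma ^+ 2 / B ^+ 2 in nmk *.
have nu0 : 0 <= nu by rewrite divr_ge0 ?sqr_ge0.
apply: (@le_trans _ _ (\sum_(X : walk_family n q s) (V ^+ q * B ^+ (q * s)) *
    (if all_repeated (edge X) then nu ^+ p X * \prod_b alpha (X b ord0) else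
        0))).
  apply: ler_sum => X _; rewrite RintegralZl //; last exact:
      bounded_measurable_integrable.
  apply: le_trans (ler_norm _) _; rewrite normrM normr_prod.
  apply: (@le_trans _ _ ((V ^+ q * \prod_b alpha (X b ord0)) *
     ((if all_repeated (edge X) then nu ^+ p X else 0) * B ^+ (q * s)))).
    apply: ler_pM => //; first exact: prodr_ge0.
      rewrite -[q in V ^+ q]card_ord -prodr_const -big_split /=.
      by apply: ler_prod => b _; rewrite normr_ge0 normrM mulrC ler_wpM2r.
    have := Rintegral_edges (edge X) B0 noise.
    by rewrite card_prod !card_ord.
  case: ifP => _; last by rewrite !(mul0r, mulr0).
  by rewrite le_eqVlt; apply/orP; left; apply/eqP; ring.
rewrite -mulr_sumr -big_mkcond /= exprMn [X in _ <= _ * X]mulrC mulrA.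
apply: ler_wpM2l; first by rewrite mulr_ge0 ?exprn_ge0.
exact: (sum_repeated_walks n0 s0 nu0 k0 mk nmk alpha01 alpha1).
Qed.

(** * Tail bounds *)

Lemma measurable_norm_gt (d : measure_display) (T : measurableType d)
    (R : realType) (Z : T -> R) (t : R) :
  measurable_fun [set: T] Z -> measurable [set w | t < `|Z w|].
Proof.
move=> mZ; have mnZ : measurable_fun [set: T] (fun w => `|Z w|).
  exact: measurableT_comp (@normr_measurable R setT) mZ.
have -> : [set w | t < `|Z w|] = (fun w => `|Z w|) @^-1` `]t, +oo[%classic.
  by apply/seteqP; split => w /=; rewrite in_itv /= andbT.
by rewrite -[X in measurable X]setTI; apply: mnZ => //; exact: measurable_itv.
Qed.

Lemma markov_even (d : measure_display) (T : measurableType d)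
    (R : realType) (P : probability T R) (Z : T -> R) (t M : R) (k : nat) :
  bounded_measurable Z -> 0 < t -> \int[P]_w Z w ^+ (2 * k) <= M ->
  (P [set w | (t < `|Z w|)%R] <= (M / t ^+ (2 * k))%:E)%E.
Proof.
move=> bZ t0 ZM; set A := [set w | _].
have mA : measurable A by apply: measurable_norm_gt; exact: bZ.1.
rewrite -[P A]fineK ?fin_num_measure // lee_fin.
rewrite ler_pdivlMr ?exprn_gt0 // mulrC -Rintegral_indic //.
rewrite -RintegralZl //; last
    exact/bounded_measurable_integrable/bounded_measurable_indic.
apply: le_trans ZM; apply: le_Rintegral => //.
- apply: (bounded_measurable_integrable P (f := fun w => t ^+ (2 * k) * \1_A
    w)).
  apply: bounded_measurableM (bounded_measurable_indic _ mA).
  exact: bounded_measurable_cst.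
- exact: bounded_measurable_integrable (bounded_measurableX _ bZ).
move=> w _; rewrite indicE; have even0 : 0 <= Z w ^+ (2 * k).
  by rewrite exprM exprn_ge0 // sqr_ge0.
case: (boolP (w \in A)) => [/set_mem /= wA|_]; last by rewrite mulr0.
rewrite mulr1 -[leRHS]ger0_norm // normrX.
by apply: lerXn2r; rewrite ?nnegrE ?(ltW t0) ?(ltW wA).
Qed.

(** The threshold exceeds the moment bound by a factor [e] per edge, so Markov's inequality with
    [2 * k * s >= 14 * L] edges gives probability at most [expR (- 14 L)], hence at most
    [n ^- 14]. *)
Lemma tail_bilinear (d : measure_display) (T : measurableType d)
    (R : realType) (P : probability T R) (cb sigma B : R) (n : nat)
    (H : 'I_n -> 'I_n -> {RV P >-> R}) (a v : 'cV[R]_n) (V K : R)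
    (L s : nat) :
  0 < B -> noise_assumption cb sigma B H -> (1 < n)%N ->
  B * ln n%:R <= K -> sigma ^+ 2 * (n%:R * ln n%:R) <= K ^+ 2 ->
  ln n%:R <= L%:R :> R -> L%:R <= 2 * ln n%:R :> R ->
  (0 < s <= 7 * L)%N ->
  \sum_i a i 0 ^+ 2 <= 1 -> 0 < V -> (forall i, `|v i 0| <= V) ->
  let E := [set w | V * (112 * expR 1 * K) ^+ s <
      `|(a^T *m (truncated_noise B H w ^+ s *m v)) 0 0|] in
  measurable E /\ (P E <= (n%:R ^- 14)%:E)%E.
Proof.
move=> B0 noise n1 BK sK Ll lL /andP[s0 sS] a1 V0 vV E.
have n0 : (0 < n)%N by apply: ltn_trans n1.
have l0 : 0 < ln n%:R :> R by rewrite ln_gt0 // ltr1n.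
have K0 : 0 < K by apply: lt_le_trans BK; rewrite mulr_gt0.
(* This [k] puts [k * s] between [S] and [2 * S]. The number of edges [2 * k * s] is thus at most
   [28 * L], and so at most [56 * ln n], whence the value [56 * K / B] of [kappa]. *)
set S := (7 * L)%N in sS *; set k := (S %/ s).+1.
have m1 : (2 * S <= 2 * k * s)%N by rewrite -mulnA leq_mul2l /= ltnW //
    ltn_ceil.
have m2 : (2 * k * s <= 28 * L)%N.
  have := leq_divM S s; rewrite /k; move: sS; rewrite /S; lia.
have mR : (2 * k * s)%:R <= 56 * ln n%:R :> R.
  apply: (@le_trans _ _ (28 * L)%:R); first by rewrite ler_nat.
  by rewrite natrM; lra.
have kap0 : 0 < 56 * K / B by rewrite divr_gt0 // mulr_gt0.
have [bZ ZM] : bounded_measurable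
    (fun w => (a^T *m (truncated_noise B H w ^+ s *m v)) 0 0) /\
  \int[P]_w ((a^T *m (truncated_noise B H w ^+ s *m v)) 0 0 ^+ (2 * k)) <=
    V ^+ (2 * k) * (2 * (56 * K / B) * B) ^+ (2 * k * s).
  apply: (bilinear_moment B0 noise) => //; first exact: ltW.
    by rewrite ler_pdivlMr //; nra.
  have -> : (56 * K / B) ^+ 2 = 56 * 56 * K ^+ 2 / B ^+ 2 by field; exact:
      lt0r_neq0.
  rewrite mulrA mulrAC ler_pM2r ?invr_gt0 ?exprn_gt0 //.
  apply: (@le_trans _ _ (56 * (sigma ^+ 2 * (n%:R * ln n%:R)))); last first.
    have := sqr_ge0 K; nra.
  have -> : 56 * (sigma ^+ 2 * (n%:R * ln n%:R)) =
      n%:R * sigma ^+ 2 * (56 * ln n%:R) by ring.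
  apply: ler_wpM2l mR; exact: mulr_ge0 (ler0n _ _) (sqr_ge0 _).
split; first by apply: measurable_norm_gt; apply: bZ.1.
have A0 : 0 < 112 * expR 1 * K by rewrite !mulr_gt0 ?expR_gt0.
have t0 : 0 < V * (112 * expR 1 * K) ^+ s by rewrite mulr_gt0 ?exprn_gt0.
apply: le_trans (markov_even bZ t0 ZM) _; rewrite lee_fin.
have -> : 2 * (56 * K / B) * B = 112 * K by field; exact: lt0r_neq0.
rewrite [(V * _) ^+ _]exprMn -exprM (mulnC s) -mulf_div divff ?mul1r; last
    first.
  by rewrite expf_neq0 ?lt0r_neq0.
rewrite -expr_div_n.
have -> : 112 * K / (112 * expR 1 * K) = expR (- 1).
  by rewrite expRN; field; rewrite (lt0r_neq0 K0) lt0r_neq0 ?expR_gt0.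
rewrite -expRM_natl -[X in _ <= X ^- _](lnK (x := n%:R)) ?posrE ?ltr0n //.
rewrite -expRM_natl -expRN ler_expR mulrN1 lerN2.
have : (14 * L)%:R <= (2 * k * s)%:R :> R.
  by rewrite ler_nat; apply: leq_trans m1; rewrite /S mulnA.
by rewrite natrM; lra.
Qed.

Lemma union_bound (d : measure_display) (T : measurableType d)
    (R : realType) (P : probability T R) (I : eqType) (r : seq I)
    (E : I -> set T) (p : R) :
  (forall i, measurable (E i)) -> (forall i, (P (E i) <= p%:E)%E) ->
  exists U : set T, [/\ measurable U, forall i, i \in r -> E i `<=` U &
    (P U <= ((size r)%:R * p)%:E)%E].
Proof.
move=> mE PE; elim: r => [|i r [U [mU EU PU]]].
  by exists set0; split => //; rewrite measure0 mul0r.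
exists (E i `|` U); split; first exact: measurableU.
  move=> j; rewrite inE => /predU1P[->|/EU jU]; first exact: subsetUl.
  exact: subset_trans jU (@subsetUr _ _ _).
apply: (le_trans (measureU2 P (mE i) mU)).
by rewrite /= -natr1 mulrDl mul1r addrC EFinD leeD.
Qed.

(** * Assembling the estimates *)

Lemma ler_entry_norm (R : realType) (n : nat) (u : 'cV[R]_n) i :
  `|u i 0| <= `|u|.
Proof.
rewrite [leRHS](mx_normrE u).
exact: (le_bigmax_cond _ (fun ij => `|u ij.1 ij.2|) (j := (i, 0))).
Qed.

Lemma incoherence_lower (R : realType) (n : nat) (u : 'cV[R]_n) (mu : R) :
  l2norm u = 1 -> incoherence_bound u mu ->
  (forall i, `|u i 0| <= Num.sqrt (mu / n%:R)) /\
  1 <= n%:R * Num.sqrt (mu / n%:R).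
Proof.
move=> /sqr_norm_sum1 u1 [_ umu]; set V := Num.sqrt _ in umu *.
have V0 : 0 <= V by exact: sqrtr_ge0.
have uV i : `|u i 0| <= V := le_trans (ler_entry_norm u i) umu.
split=> //; have nV2 : 1 <= n%:R * V ^+ 2.
  have -> : n%:R * V ^+ 2 = \sum_(i < n) V ^+ 2 by rewrite sumr_const card_ord
      mulr_natl.
  rewrite -[leLHS]u1; apply: ler_sum => i _.
  by rewrite -real_normK ?num_real //; apply: lerXn2r; rewrite ?nnegrE.
have n1 : 1 <= n%:R :> R.
  by rewrite ler1n lt0n; apply: contraTneq nV2 => ->; rewrite mul0r ler10.
rewrite -(@ler_pXn2r _ 2) ?nnegrE ?mulr_ge0 // expr1n exprMn expr2 -mulrA.
by apply: le_trans nV2 _; rewrite ler_peMl // mulr_ge0 ?sqr_ge0.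
Qed.

(** A real eigenvalue of the matrix is also one of its complexification, so the leading modulus
    dominates it. For negative [lam] one passes to the opposite matrix, the powers of [- H] agreeing
    with those of [H] up to sign. *)
Lemma leading_eigenvalue_lower (R : realType) (n S : nat) (H : 'M[R]_n)
    (u : 'cV[R]_n) (lam rho : R) (l : R[i]) :
  (0 < S)%N -> lam != 0 -> 0 <= rho ->
  rho / (`|lam| / 2) <= 50^-1 ->
  n%:R ^+ 3 * (rho / (`|lam| / 2)) ^+ S <= 32^-1 ->
  l2norm u = 1 ->
  (forall s, (0 < s < S)%N -> `|(u^T *m (H ^+ s *m u)) 0 0| <= rho ^+ s) ->
  (forall s i j, (0 < s <= S)%N -> `|(H ^+ s) i j| <= rho ^+ s) ->
  leading_eigenvalue (lam *: (u *m u^T) + H) l -> `|lam| / 2 <= Normc.normc l.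
Proof.
move=> S0 lam0 rho0 r50 nr /sqr_norm_sum1 u1 Hu Hij [_ lmax].
suff [z zl ez] : exists2 z, `|lam| / 2 <= `|z| &
    eigenvalue (lam *: (u *m u^T) + H) z.
  have := lmax (real_complex R z); rewrite normc_real => le_z.
  by apply: le_trans zl (le_z _); rewrite /complexify eigenvalue_map ez.
have lamp : 0 < `|lam| by rewrite normr_gt0.
have [lam_gt0|lam_lt0|/eqP] := ltgtP 0 lam; last by rewrite eq_sym (negPf lam0).
  have [z zl ez] := @large_eigenvalue R n S H u `|lam| rho S0 lamp rho0 r50 nr
      u1 Hu Hij.
  exists z; first by apply: le_trans zl (ler_norm z).
  by rewrite gtr0_norm in ez.
have expN s : (- H) ^+ s = (-1) ^+ s *: H ^+ s.
  elim: s => [|s IH]; first by rewrite !expr0 scale1r.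
  rewrite !exprS IH -!mulmxE -scalemxAr.
  by rewrite mulNmx scalerN -scaleNr mulN1r.
have normN1 s : `|(-1) ^+ s| = 1 :> R by rewrite normrX normrN1 expr1n.
have [||z zl ez] := @large_eigenvalue R n S (- H) u `|lam| rho S0 lamp rho0 r50
    nr u1.
- by move=> s sS; rewrite expN -scalemxAl -scalemxAr mxE normrM normN1 mul1r Hu.
- by move=> s i j sS; rewrite expN mxE normrM normN1 mul1r Hij.
exists (- z); first by rewrite normrN (le_trans zl) // ler_norm.
move: ez; rewrite ltr0_norm // scaleNr -opprD.
move=> /eigenvalueP[v vM v0]; apply/eigenvalueP; exists v => //.
by rewrite scaleNr -vM mulmxN opprK.
Qed.

Lemma prob_noise_gt (d : measure_display) (T : measurableType d)
    (R : realType) (P : probability T R) (cb sigma B : R) (n : nat)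
    (H : 'I_n -> 'I_n -> {RV P >-> R}) i j :
  0 <= cb -> noise_assumption cb sigma B H ->
  measurable [set w | B < `|H i j w|] /\
  (P [set w | (B < `|H i j w|)%R] <= (cb * n%:R ^- 12)%:E)%E.
Proof.
move=> cb0 noise.
have mE : measurable [set w | B < `|H i j w|].
  by apply: measurable_norm_gt; exact: measurable_funPT.
split=> //; case: (noise_tail noise i j) => [aeB|[_ //]].
rewrite [X in (X <= _)%E]measure_negligible //.
  by rewrite lee_fin mulr_ge0 // invr_ge0 exprn_ge0.
by apply: negligibleS aeB => w /= wB; apply/negP; rewrite -ltNge.
Qed.

Lemma bilinear_delta (R : pzSemiRingType) (n : nat) (A : 'M[R]_n) (i j : 'I_n) :
  ((delta_mx i 0 : 'cV[R]_n)^T *m (A *m (delta_mx j 0 : 'cV[R]_n))) 0 0 = A i j.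
Proof. by rewrite trmx_delta -rowE -colE !mxE. Qed.

Lemma sqr_sum_delta (R : realDomainType) (n : nat) (i : 'I_n) :
  \sum_k (delta_mx i 0 : 'cV[R]_n) k 0 ^+ 2 = 1.
Proof.
rewrite (bigD1 i) //= big1 => [|k /negPf ki]; last by rewrite mxE ki expr0n.
by rewrite mxE !eqxx expr1n addr0.
Qed.

Lemma log_ceiling (R : realType) (x : R) : 1 <= x ->
  exists L : nat, [/\ (0 < L)%N, x <= L%:R & L%:R <= 2 * x].
Proof.
move=> x1; have x0 : 0 <= x by apply: le_trans x1.
exists (Num.trunc x).+1; have /andP[t1 t2] := truncn_itv x0.
by split=> //; [exact: ltW | rewrite -natr1; lra].
Qed.

(** Since [(7 * L).-1 >= 6 * L], the power of [r] is at most [expR (- 24 L)], which beats [n ^+ 3].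
    One more factor [r <= 1/50] gives the second bound. *)
Lemma power_decay (R : realType) (n L : nat) (r : R) :
  (0 < n)%N -> (0 < L)%N -> ln n%:R <= L%:R :> R ->
  0 <= r <= expR (- 4) / 50 ->
  n%:R ^+ 3 * r ^+ (7 * L).-1 <= 1 /\ n%:R ^+ 3 * r ^+ (7 * L) <= 32^-1.
Proof.
move=> n0 L0 lL /andP[r0 r4].
have e41 : expR (- 4) <= 1 :> R by rewrite -[leRHS]expR0 ler_expR; lra.
have e40 := expR_gt0 (- 4 : R).
have d1 : n%:R ^+ 3 * r ^+ (7 * L).-1 <= 1.
  apply: (@le_trans _ _ (n%:R ^+ 3 * expR (- 4) ^+ (7 * L).-1)).
    rewrite ler_wpM2l ?exprn_ge0 //; apply: lerXn2r; rewrite ?nnegrE ?(ltW e40)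
        //; lra.
  rewrite -[n%:R](lnK (x := n%:R)) ?posrE ?ltr0n // -!expRM_natl -expRD
      -[leRHS]expR0 ler_expR.
  have : (6 * L)%:R <= (7 * L).-1%:R :> R by rewrite ler_nat; lia.
  by rewrite natrM; have := ler0n R L; lra.
split=> //; have -> : (7 * L = (7 * L).-1.+1)%N by lia.
rewrite (exprSr r) mulrA; have := ler_wpM2r r0 d1; lra.
Qed.

Theorem theorem3 (R : realType) (cb : R) (hcb : 0 < cb) :
  exists c1 C C' : R, [/\ 0 < c1, 0 < C, 0 < C' &
    forall (n : nat) (lambdastar : R) (ustar : 'cV[R]_n) (mu : R),
      lambdastar != 0 ->
      l2norm ustar = 1 ->
      incoherence_parameter ustar mu ->
    forall (d : measure_display) (T : measurableType d) (P : probability T R)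
      (sigma B : R) (H : 'I_n -> 'I_n -> {RV P >-> R}),
      0 <= sigma -> 0 < B ->
      noise_assumption cb sigma B H ->
      Num.max (sigma * Num.sqrt (n%:R * ln n%:R)) (B * ln n%:R)
        <= c1 * `|lambdastar| ->
    forall (lambda : T -> R[i]) (u : T -> 'cV[R[i]]_n),
      (forall w : T,
        leading_eigenpair
          (lambdastar *: (ustar *m ustar^T) + noise_matrix H w)
          (lambda w) (u w)) ->
    forall a : 'cV[R]_n, l2norm a = 1 ->
      with_probability_at_least P (1 - C' * n%:R ^- 10)
        [set w : T |
          Normc.normc
            (((complexify a)^T *m
               (u w - (((complexify ustar)^T *m u w) 0 0
                        / (lambda w / real_complex R lambdastar))
                      *: complexify ustar)) 0 0)
          <= C * (Num.max (sigma * Num.sqrt (n%:R * ln n%:R)) (B * ln n%:R)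
                   / `|lambdastar|) * Num.sqrt (mu / n%:R)]].
Proof.
have e1 := expR_gt0 (1 : R); have e4 := expR_gt0 (- 4 : R).
pose A : R := 112 * expR 1; have A0 : 0 < A by rewrite mulr_gt0.
(* [c1] makes the ratio [r] of [A * K] to [|lam| / 2] at most [expR (- 4) / 50], and [C] comes from
   [5 * r = 10 * A * K / |lam|]. In [C'], 42 pays for the moment bounds, [cb] for the truncation,
   and [expR 1 ^+ 10] for small [n]. *)
exists (expR (- 4) / (100 * A)), (10 * A), (42 + cb + expR 1 ^+ 10).
split; [by rewrite divr_gt0 // mulr_gt0 | by rewrite mulr_gt0 | |].
  by rewrite !addr_gt0 // exprn_gt0.
move=> n lam u0 mu lam0 u1 [incoh _] d T P sigma B H sigma0 B0 noise.
set K := Num.max _ _ => Kc1 l u lead a a1.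
have n0 : (0 < n)%N.
  case: n u0 u1 {incoh H noise u lead a a1 K Kc1} => // u0 /sqr_norm_sum1.
  by rewrite big_ord0 => /esym/eqP; rewrite oner_eq0.
have nR0 : 0 < n%:R :> R by rewrite ltr0n.
(* For [n] below [e] the claimed probability is not positive and the empty event serves; from [e]
   on, [ln n >= 1]. *)
have [small|big] := ltP n%:R (expR 1 : R).
  exists set0; split => //; rewrite measure0 lee_fin subr_le0.
  rewrite ler_pdivlMr ?exprn_gt0 // mul1r.
  apply: (@le_trans _ _ (expR 1 ^+ 10)); last by rewrite lerDr addr_ge0 // ltW.
  by apply: lerXn2r; rewrite ?nnegrE ?ltW.
have l1 : 1 <= ln n%:R :> R by rewrite -[leLHS]expRK ler_ln ?posrE.
have [L [L0 lL Ll]] := log_ceiling l1.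
set S := (7 * L)%N; have S0 : (0 < S)%N by rewrite /S; lia.
have n1 : (1 < n)%N.
  have : 1 < n%:R :> R by apply: lt_le_trans big; rewrite expR_gt1.
  by rewrite ltr1n.
have BK : B * ln n%:R <= K by rewrite /K le_max lexx orbT.
have K0 : 0 < K by apply: lt_le_trans BK; rewrite mulr_gt0 // (lt_le_trans _
    l1).
have sK : sigma ^+ 2 * (n%:R * ln n%:R) <= K ^+ 2.
  rewrite -[X in _ * X]sqr_sqrtr ?mulr_ge0 ?(ltW nR0) ?(le_trans _ l1) //
      -exprMn.
  apply: lerXn2r; rewrite ?nnegrE ?mulr_ge0 ?sqrtr_ge0 ?(ltW K0) //.
  by rewrite /K le_max lexx.
set V := Num.sqrt (mu / n%:R).
have [uV nV] := incoherence_lower u1 incoh.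
have V0 : 0 < V.
  by rewrite -(pmulr_rgt0 _ nR0) (lt_le_trans _ nV).
have u_le1 (v : 'cV[R]_n) i : l2norm v = 1 -> `|v i 0| <= 1.
  move=> /sqr_norm_sum1 v1; rewrite -(@ler_pXn2r _ 2) ?nnegrE // expr1n.
  rewrite real_normK ?num_real // -v1 (bigD1 i) //= lerDl sumr_ge0 // => j _.
  exact: sqr_ge0.
(* An index names a power and a form: [None] pairs [a] with [u0], [Some None] pairs [u0] with
   itself, and the others are matrix entries. Only the first needs the incoherence bound [V]. The
   ordinal [s] stands for the power [s.+1]. *)
pose I := ('I_S * option (option ('I_n * 'I_n)))%type.
pose left (o : option (option ('I_n * 'I_n))) : 'cV[R]_n :=
  match o with None => a | Some None => u0 | Some (Some ij) => delta_mx ij.1 0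
      end.
pose right (o : option (option ('I_n * 'I_n))) : 'cV[R]_n :=
  match o with None => u0 | Some None => u0 | Some (Some ij) => delta_mx ij.2 0
      end.
pose bound (o : option (option ('I_n * 'I_n))) : R := if o is None then V else
    1.
pose E2 (i : I) := [set w | bound i.2 * (A * K) ^+ i.1.+1 <
  `|((left i.2)^T *m (truncated_noise B H w ^+ i.1.+1 *m right i.2)) 0 0|].
have E2P i : measurable (E2 i) /\ (P (E2 i) <= (n%:R ^- 14)%:E)%E.
  case: i => s o; apply: (tail_bilinear B0 noise n1 BK sK lL Ll).
  - by rewrite /= ltn_ord.
  - by case: o => [[ij|]|] /=; rewrite ?sqr_sum_delta ?sqr_norm_sum1.
  - by case: o => [[ij|]|] /=.
  - case: o => [[ij|]|] k /=; [|exact: u_le1|exact: uV].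
    by rewrite mxE; case: (_ && _); rewrite ?normr1 ?normr0.
have E1P ij := prob_noise_gt ij.1 ij.2 (ltW hcb) noise.
have [U1 [mU1 sU1 PU1]] := union_bound (enum {: 'I_n * 'I_n})
  (fun ij => (E1P ij).1) (fun ij => (E1P ij).2).
have [U2 [mU2 sU2 PU2]] := union_bound (enum {: I})
  (fun i => (E2P i).1) (fun i => (E2P i).2).
exists (~` (U1 `|` U2)); split.
- by apply: measurableC; exact: measurableU.
- move=> w /= /not_orP[wU1 wU2].
  (* Outside [U1] no entry exceeds [B], so the bounds for the truncated matrix hold for the noise
     itself. *)
  have trunc : truncated_noise B H w = noise_matrix H w.
    apply/matrixP => i j; rewrite !mxE /truncate.
    case: ifP => // /negbT; rewrite -ltNge => wB; exfalso; apply: wU1.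
    by apply: (sU1 (i, j)) wB; rewrite mem_enum.
  have powers o s : (0 < s <= S)%N ->
      `|((left o)^T *m (noise_matrix H w ^+ s *m right o)) 0 0| <=
        bound o * (A * K) ^+ s.
    case: s => // s /= sS; rewrite leNgt; apply/negP => ws; apply: wU2.
    by apply: (sU2 (Ordinal sS, o)); rewrite ?mem_enum //= /E2 /= trunc.
  set H' := noise_matrix H w in powers.
  have [[lead1 lead2] Mu uw1 _] := lead w.
  have lamp : 0 < `|lam| by rewrite normr_gt0.
  have AK0 : 0 <= A * K by rewrite mulr_ge0 // ltW.
  set r := A * K / (`|lam| / 2).
  have r4 : 0 <= r <= expR (- 4) / 50.
    rewrite /r divr_ge0 ?divr_ge0 //= ler_pdivrMr ?divr_gt0 //.
    have -> : expR (- 4) / 50 * (`|lam| / 2) =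
      A * (expR (- 4) / (100 * A) * `|lam|) by field; exact: lt0r_neq0.
    by rewrite ler_wpM2l // ltW.
  have [d1 d2] := power_decay n0 L0 lL r4.
  have e41 : expR (- 4) <= 1 :> R by rewrite -[leRHS]expR0 ler_expR; lra.
  have r50 : r <= 50^-1 by lra.
  have Hij s i j : (0 < s <= S)%N -> `|(H' ^+ s) i j| <= (A * K) ^+ s.
    by move=> /(powers (Some (Some (i, j)))); rewrite bilinear_delta mul1r.
  have l_ge : `|lam| / 2 <= Normc.normc (l w).
    apply: (leading_eigenvalue_lower S0 lam0 AK0 r50 d2 u1 _ Hij); last by
        split.
    move=> s /andP[s0 sS]; have := powers (Some None) s; rewrite mul1r; apply.
    by rewrite s0 ltnW.
  (* The eigenvector expansion is used with [S.-1], so that its remainder involves the power [S],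
     the last one controlled. *)
  have SE : S = S.-1.+1 by rewrite prednK.
  have := eigenvector_linear_form (S := S.-1) (rho := A * K) (V := V)
    lam0 AK0 r50 d1 u1 a1 _ _ (ltW V0) nV l_ge Mu uw1.
  rewrite -/H' => /(_ _ _)/le_trans; apply.
  + by move=> s /andP[s0 sS]; apply: (powers None); rewrite s0 (leq_trans sS)
      // leq_pred.
  + by move=> i j; rewrite -SE; apply: Hij; rewrite S0 leqnn.
  + rewrite le_eqVlt; apply/orP; left; apply/eqP; rewrite -/V; field.
    exact: lt0r_neq0.
- rewrite probability_setC; last exact: measurableU.
  have PU : (P (U1 `|` U2) <= ((42 + cb + expR 1 ^+ 10) * n%:R ^- 10)%:E)%E.
    apply: (le_trans (measureU2 P mU1 mU2)); apply: (le_trans (leeD PU1 PU2)).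
    rewrite -EFinD lee_fin -!cardE !card_prod !card_option card_prod !card_ord.
    set x : R := n%:R; have x1 : 1 <= x by rewrite ler1n.
    have x0 : x != 0 by rewrite lt0r_neq0.
    have xV : 0 <= x ^- 10 by rewrite invr_ge0 exprn_ge0 // ltW.
    (* There are [S * (n * n + 2)] moment events, at most [14 x * 3 x^2 = 42 x^3]; at probability
       [x ^- 14] each, their total is within [42 * x ^- 10]. *)
    have Sx : S%:R <= 14 * x.
      have : L%:R <= 2 * x by apply: le_trans Ll _; rewrite ler_wpM2l // ltW //
          ln_sublinear.
      by rewrite /S natrM; lra.
    have n2 : (n * n).+2%:R <= 3 * x ^+ 2.
      have : 1 <= x ^+ 2 by rewrite exprn_ege1.
      by rewrite -2!natr1 natrM -/x -expr2; lra.
    have -> : (n * n)%:R * (cb * x ^- 12) = cb * x ^- 10.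
      by rewrite natrM -/x; field.
    have : (S * (n * n).+2)%:R * x ^- 14 <= 42 * x ^- 10.
      apply: (@le_trans _ _ (42 * x ^+ 3 * x ^- 14)).
        rewrite ler_wpM2r ?invr_ge0 ?exprn_ge0 ?(ltW nR0) // natrM.
        have -> : 42 * x ^+ 3 = (14 * x) * (3 * x ^+ 2) by ring.
        exact: ler_pM.
      have -> : 42 * x ^+ 3 * x ^- 14 = 42 * x ^- 10 * x^-1 by field.
      by rewrite ler_piMr ?mulr_ge0 // invf_le1.
    have : 0 <= expR 1 ^+ 10 * x ^- 10 by rewrite mulr_ge0 ?exprn_ge0 ?(ltW e1).
    lra.
  by rewrite EFinB leeB.
Qed.
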